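(* Let $\chi:\mathbb{R}\to\mathbb{R}$ be a kernel satisfying $(\chi_1)$ and $(\chi_2)$, let $m\in\mathbb{N}$, $m\ge1$, and let $f\in BV(\mathbb{R})$. Then $$\lim_{w\to+\infty}V[\bar S^m_w f-f]=0$$ if and only if $f\in AC(\mathbb{R})$.
   Context: For $f:\mathbb{R}\to\mathbb{R}$, $V[f]$ denotes the Jordan variation of $f$ over $\mathbb{R}$ (supremum over compact intervals $[a,b]$ of the supremum over partitions $a=x_0<\dots<x_n=b$ of $\sum_i|f(x_i)-f(x_{i-1})|$); $BV(\mathbb{R})=\{f: V[f]<\infty\}$; $AC(\mathbb{R}):=BV(\mathbb{R})\cap AC_{loc}(\mathbb{R})$, where $AC_{loc}(\mathbb{R})$ is the set of functions absolutely continuous on every compact interval. A kernel $\chi:\mathbb{R}\to\mathbb{R}$ satisfies: $(\chi_1)$ $\chi\in L^1(\mathbb{R})$ is continuous and $\sum_{k\in\mathbb{Z}}\chi(u-k)=1$ for all $u\in\mathbb{R}$; $(\chi_2)$ $\sup_{u\in\mathbb{R}}\sum_{k\in\mathbb{Z}}|\chi(u-k)|<+\infty$, the series converging uniformly on compact sets. The averaged kernel is $\bar\chi_m(t):=\frac1m\int_{-m/2}^{m/2}\chi(t+v)\,dv$, and $(\bar S^m_w f)(t):=\sum_{k\in\mathbb{Z}} f(k/w)\,\bar\chi_m(wt-k)$, $t\in\mathbb{R}$, $w>0$. *)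

(* Defs.v *)
From Stdlib Require Import Reals Lra List ZArith ClassicalEpsilon.
Open Scope R_scope.

Fixpoint incr (x0 : R) (l : list R) : Prop :=
  match l with nil => True | x :: l' => x0 < x /\ incr x l' end.

Fixpoint var_sum (f : R -> R) (x0 : R) (l : list R) : R :=
  match l with nil => 0 | x :: l' => Rabs (f x - f x0) + var_sum f x l' end.

Definition var_le (f : R -> R) (M : R) : Prop :=
  forall x0 l, incr x0 l -> var_sum f x0 l <= M.

Definition BV (f : R -> R) : Prop := exists M, var_le f M.

(* lim_{w -> +oo} V[g w] = 0  (V takes values in [0,+oo]) *)
Definition var_tends_to_0 (g : R -> R -> R) : Prop :=
  forall eps, 0 < eps -> exists W, forall w, W < w -> var_le (g w) eps.

Fixpoint nonoverlap (x0 : R) (l : list (R * R)) : Prop :=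
  match l with
  | nil => True
  | (a, b) :: l' => x0 <= a /\ a < b /\ nonoverlap b l'
  end.

Fixpoint len_sum (l : list (R * R)) : R :=
  match l with nil => 0 | (a, b) :: l' => (b - a) + len_sum l' end.

Fixpoint osc_sum (f : R -> R) (l : list (R * R)) : R :=
  match l with nil => 0 | (a, b) :: l' => Rabs (f b - f a) + osc_sum f l' end.

Definition AC_on (f : R -> R) (a b : R) : Prop :=
  forall eps, 0 < eps -> exists delta, 0 < delta /\
    forall l, nonoverlap a l -> Forall (fun p => snd p <= b) l ->
      len_sum l < delta -> osc_sum f l < eps.

Definition AC_loc (f : R -> R) : Prop := forall a b, a < b -> AC_on f a b.

Definition AC (f : R -> R) : Prop := BV f /\ AC_loc f.

Definition Zrange (a : Z -> R) (m n : nat) : R :=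
  sum_f_R0 (fun i => a (Z.of_nat i - Z.of_nat m)%Z) (m + n).

Definition Zseries_cv (a : Z -> R) (l : R) : Prop :=
  forall eps, 0 < eps -> exists N : nat, forall m n : nat,
    (N <= m)%nat -> (N <= n)%nat -> Rabs (Zrange a m n - l) < eps.

Definition Zseries_sum (a : Z -> R) : R :=
  epsilon (inhabits 0) (fun l => Zseries_cv a l).

(* Riemann integral of f over [a,b] (value; f integrable in our uses) *)
Definition RInt (f : R -> R) (a b : R) : R :=
  epsilon (inhabits 0)
    (fun l => exists pr : Riemann_integrable f a b, RiemannInt pr = l).

(* chi in L^1(R), for continuous chi: integrals of |chi| over compact
   intervals are uniformly bounded *)
Definition L1_cont (chi : R -> R) : Prop :=
  exists M, forall a b (pr : Riemann_integrable (fun x => Rabs (chi x)) a b),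
    a <= b -> RiemannInt pr <= M.

Definition chi1 (chi : R -> R) : Prop :=
  continuity chi /\ L1_cont chi /\
  forall u, Zseries_cv (fun k => chi (u - IZR k)) 1.

Definition chi2 (chi : R -> R) : Prop :=
  exists sigma : R -> R,
    (forall a b eps, a <= b -> 0 < eps -> exists N : nat, forall m n : nat,
       (N <= m)%nat -> (N <= n)%nat -> forall u, a <= u <= b ->
       Rabs (Zrange (fun k => Rabs (chi (u - IZR k))) m n - sigma u) < eps) /\
    (exists M, forall u, sigma u <= M).

Definition chibar (chi : R -> R) (m : nat) (t : R) : R :=
  / INR m * RInt (fun v => chi (t + v)) (- (INR m / 2)) (INR m / 2).

Definition Sbar (chi : R -> R) (m : nat) (w : R) (f : R -> R) (t : R) : R :=
  Zseries_sum (fun k => f (IZR k / w) * chibar chi m (w * t - IZR k)).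

(* Main.v *)
Require Import Defs.
From Stdlib Require Import Reals Lra Lia List ZArith.
From Coquelicot Require Import Coquelicot.
Open Scope R_scope.

(** Let P and Q be primitives of chi and |chi|.  Summation by parts turns the
    increments of Sbar f into sums of (increments of f over steps m/w) times
    (increments of P), which gives V[Sbar f] <= ||chi||_1 V[f] and shows that
    Sbar f is Lipschitz.  Absolute continuity passes to limits in variation,
    whence necessity.  For sufficiency it is enough, by the bound on V[Sbar f],
    to treat a class of functions that is dense in AC for the variation:
    polygons, that is linear combinations of the truncations [clamp a b].
    For a truncation, the slope of Sbar f is close to the right one away from
    a and b because sum chi(u - k) = 1, it is bounded near a and b, and the
    variation far outside [a,b] is a tail of the integral of |chi|.

    Density: a polygon inscribed in f whose arc length is almost maximal is
    close to f in variation.  Indeed for every refinement with slopes s, the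
    quantity |s - p| (p the coarse slope) is bounded by a small constant, plus a
    multiple of the Bregman divergence of sqrt(1 + x^2), whose total is the gain
    in arc length, plus (|s| - K)^+ and (|p| - K)^+, whose totals are small for
    large K by absolute continuity. *)

(** * Partitions and variation *)

(** Repetitions are allowed because partitions are pushed forward by truncations, which are monotone
    but not injective. *)
Fixpoint wincr (x0 : R) (l : list R) : Prop :=
  match l with nil => True | x :: l' => x0 <= x /\ wincr x l' end.

(** Variation, arc length and excess are all sums of this kind, for different interval functions
    [j]. *)
Fixpoint psum (j : R -> R -> R) (x0 : R) (l : list R) : R :=
  match l with nil => 0 | x :: l' => j x0 x + psum j x l' end.

Fixpoint endpt (x0 : R) (l : list R) : R :=
  match l with nil => x0 | x :: l' => endpt x l' end.

(** It has two uses: as a function of slope 1 on [[a,b]] and constant elsewhere, the building block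
    of polygons, and as an inner map that restricts a function to [[a,b]]. *)
Definition clamp (a b t : R) : R := Rmax a (Rmin t b).

Lemma incr_wincr x0 l : incr x0 l -> wincr x0 l.
Proof.
  revert x0; induction l as [|x l IH]; simpl; intros x0; [easy|].
  intros [H1 H2]; split; [lra|auto].
Qed.

Lemma var_sum_psum f x0 l :
  var_sum f x0 l = psum (fun u v => Rabs (f v - f u)) x0 l.
Proof.
  revert x0; induction l as [|x l IH]; simpl; intros x0; [easy|now rewrite IH].
Qed.

Lemma psum_app j x0 l1 l2 :
  psum j x0 (l1 ++ l2) = psum j x0 l1 + psum j (endpt x0 l1) l2.
Proof.
  revert x0; induction l1 as [|x l IH]; simpl; intros x0; [ring|rewrite IH; ring].
Qed.

Lemma endpt_app x0 l1 l2 : endpt x0 (l1 ++ l2) = endpt (endpt x0 l1) l2.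
Proof. revert x0; induction l1 as [|x l IH]; simpl; intros x0; auto. Qed.

Lemma wincr_app x0 l1 l2 :
  wincr x0 l1 -> wincr (endpt x0 l1) l2 -> wincr x0 (l1 ++ l2).
Proof.
  revert x0; induction l1 as [|x l IH]; simpl; intros x0; [easy|].
  intros [H1 H2] H3; auto.
Qed.

Lemma wincr_endpt x0 l : wincr x0 l -> x0 <= endpt x0 l.
Proof.
  revert x0; induction l as [|x l IH]; simpl; intros x0; [lra|].
  intros [H1 H2]; specialize (IH x H2); lra.
Qed.

Lemma wincr_map psi x0 l :
  (forall u v, u <= v -> psi u <= psi v) ->
  wincr x0 l -> wincr (psi x0) (map psi l).
Proof.
  intros Hpsi; revert x0; induction l as [|x l IH]; simpl; intros x0; [easy|].
  intros [H1 H2]; auto.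
Qed.

Lemma endpt_map psi x0 l : endpt (psi x0) (map psi l) = psi (endpt x0 l).
Proof. revert x0; induction l as [|x l IH]; simpl; intros x0; auto. Qed.

Lemma psum_map j psi x0 l :
  psum j (psi x0) (map psi l) = psum (fun u v => j (psi u) (psi v)) x0 l.
Proof.
  revert x0; induction l as [|x l IH]; simpl; intros x0; [easy|now rewrite IH].
Qed.

Lemma wincr_dedup j x0 l :
  (forall u, j u u = 0) -> wincr x0 l ->
  exists l', incr x0 l' /\ psum j x0 l' = psum j x0 l.
Proof.
  intros Hj; revert x0; induction l as [|x l IH]; simpl; intros x0.
  - intros _; now exists nil.
  - intros [H1 H2]; destruct (IH x H2) as [l' [H3 H4]].
    destruct H1 as [H1|H1].
    + exists (x :: l'); simpl; rewrite H4; auto.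
    + subst; exists l'; rewrite Hj, H4; split; [easy|ring].
Qed.

Lemma var_le_wincr f M x0 l : var_le f M -> wincr x0 l -> var_sum f x0 l <= M.
Proof.
  intros Hf Hl.
  destruct (wincr_dedup (fun u v => Rabs (f v - f u)) x0 l) as [l' [H1 H2]]; auto.
  { intros u; replace (f u - f u) with 0 by ring; apply Rabs_R0. }
  rewrite var_sum_psum, <- H2, <- var_sum_psum; auto.
Qed.

Lemma var_sum_triangle f g h x0 l :
  (forall u v, Rabs (f v - f u) <= Rabs (g v - g u) + Rabs (h v - h u)) ->
  var_sum f x0 l <= var_sum g x0 l + var_sum h x0 l.
Proof.
  intros H; revert x0; induction l as [|x l IH]; simpl; intros x0; [lra|].
  specialize (IH x); specialize (H x0 x); lra.
Qed.

Lemma var_le_sum f g h M N :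
  (forall u v, f v - f u = (g v - g u) + (h v - h u)) ->
  var_le g M -> var_le h N -> var_le f (M + N).
Proof.
  intros H Hg Hh x0 l Hl.
  apply Rle_trans with (var_sum g x0 l + var_sum h x0 l).
  - apply var_sum_triangle; intros u v; rewrite H; apply Rabs_triang.
  - apply Rplus_le_compat; auto.
Qed.

Lemma var_le_scal f g c M :
  (forall u v, f v - f u = c * (g v - g u)) ->
  var_le g M -> var_le f (Rabs c * M).
Proof.
  intros H Hg x0 l Hl.
  replace (var_sum f x0 l) with (Rabs c * var_sum g x0 l).
  - apply Rmult_le_compat_l; [apply Rabs_pos|auto].
  - clear Hl Hg; revert x0; induction l as [|x l IH]; simpl; intros x0; [ring|].
    rewrite H, Rabs_mult, <- IH; ring.
Qed.

Lemma var_le_weaken f M N : M <= N -> var_le f M -> var_le f N.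
Proof. intros H Hf x0 l Hl; specialize (Hf x0 l Hl); lra. Qed.

Lemma var_le_nonneg f M : var_le f M -> 0 <= M.
Proof. intros H; exact (H 0 nil I). Qed.

Lemma var_le_bounded f M x y : var_le f M -> Rabs (f y - f x) <= M.
Proof.
  intros H.
  destruct (Rle_dec x y) as [h|h].
  - generalize (var_le_wincr f M x (y :: nil) H); simpl; intros H1.
    assert (Rabs (f y - f x) + 0 <= M) by (apply H1; auto); lra.
  - generalize (var_le_wincr f M y (x :: nil) H); simpl; intros H1.
    assert (Rabs (f x - f y) + 0 <= M) by (apply H1; split; [lra|auto]).
    rewrite Rabs_minus_sym; lra.
Qed.

(** Extremal principle behind many estimates below: once a configuration is within [eps] of the
    supremum, whatever is added to it contributes less than [eps]. *)
Lemma lub_approx (E : R -> Prop) (M x0 eps : R) :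
  E x0 -> (forall x, E x -> x <= M) -> 0 < eps ->
  exists s x, E x /\ s - eps < x /\ forall y, E y -> y <= s.
Proof.
  intros H0 HM Heps.
  destruct (completeness E) as [s [Hs1 Hs2]].
  - now exists M.
  - now exists x0.
  - exists s; destruct (Classical_Prop.classic (exists x, E x /\ s - eps < x))
      as [[x [H1 H2]]|H].
    + exists x; auto.
    + exfalso; assert (s <= s - eps); [|lra].
      apply Hs2; intros x Hx; apply Rnot_lt_le; intros H1; apply H; eauto.
Qed.

(** * Approximation of absolutely continuous functions by polygons *)

(* If [a = b] this is [0 / 0 = 0], so that [slope f a b * (b - a) = f b - f a] still holds. *)
Definition slope (f : R -> R) (a b : R) : R := (f b - f a) / (b - a).

(** Up to an additive constant, which variation ignores, this is the polygon inscribed in the graph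
    of [f] at the nodes and constant beyond them. *)
Fixpoint polygon (f : R -> R) (x0 : R) (l : list R) (t : R) : R :=
  match l with
  | nil => 0
  | x :: l' => slope f x0 x * clamp x0 x t + polygon f x l' t
  end.

Definition arc (f : R -> R) (u v : R) : R :=
  sqrt ((v - u) * (v - u) + (f v - f u) * (f v - f u)).

(** For [u < v] and [s] the slope on [[u,v]], this is [(v - u)] times the positive part of
    [|s| - K]. *)
Definition excess (f : R -> R) (K u v : R) : R :=
  Rmax 0 (Rabs (f v - f u) - K * (v - u)).

Lemma clamp_mono a b u v : u <= v -> clamp a b u <= clamp a b v.
Proof.
  intros H; unfold clamp; apply Rle_max_compat_l.
  now apply Rle_min_compat_r.
Qed.

Lemma clamp_bounds a b t : a <= b -> a <= clamp a b t <= b.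
Proof.
  intros H; unfold clamp; split; [apply Rmax_l|].
  apply Rmax_lub; [easy|apply Rmin_r].
Qed.

Lemma slope_mult f a b : a <= b -> slope f a b * (b - a) = f b - f a.
Proof.
  intros [H|H]; unfold slope; [field; lra|subst; ring].
Qed.

(** Up to a constant, [f] to the right of [a] is its part on [[a,b]] plus its part to the right of
    [b]. This lets variation bounds be proved cell by cell. *)
Lemma split_max f a b t :
  a <= b -> f (Rmax t a) = f (clamp a b t) + f (Rmax t b) - f b.
Proof.
  intros H; unfold clamp.
  destruct (Rle_dec t b) as [h|h].
  - rewrite (Rmin_left t b), (Rmax_right t b), (Rmax_comm a t) by lra; ring.
  - rewrite (Rmin_right t b), (Rmax_right a b), (Rmax_left t b), (Rmax_left t a)
      by lra; ring.
Qed.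

Lemma split_min_max f c t : f t = f (Rmin t c) + f (Rmax t c) - f c.
Proof.
  destruct (Rle_dec t c) as [h|h].
  - rewrite Rmin_left, Rmax_right by lra; ring.
  - rewrite Rmin_right, Rmax_left by lra; ring.
Qed.

(* The bracket is the Bregman divergence of [sqrt (1 + x^2)] between [s] and [p]. *)
Lemma bregman_bound K e s p :
  0 <= K -> 0 < e ->
  Rabs (s - p) <= e + (1 + 2 * K) ^ 3 / e *
      (sqrt (1 + s * s) - (1 + p * s) / sqrt (1 + p * p))
    + 4 * Rmax 0 (Rabs s - K) + 4 * Rmax 0 (Rabs p - K).
Proof.
  intros HK He.
  set (a := sqrt (1 + s * s)); set (b := sqrt (1 + p * p)).
  assert (Ha : a * a = 1 + s * s) by (apply sqrt_sqrt; nra).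
  assert (Hb : b * b = 1 + p * p) by (apply sqrt_sqrt; nra).
  assert (Ha0 : 0 < a) by (apply sqrt_lt_R0; nra).
  assert (Hb0 : 0 < b) by (apply sqrt_lt_R0; nra).
  set (D := a - (1 + p * s) / b).
  assert (HD : b * D = a * b - (1 + p * s)) by (unfold D; field; lra).
  assert (Hab : 0 < a * b) by nra.
  (* Lagrange's identity for the vectors [(1,p)] and [(1,s)]. *)
  assert (Hsq : (a * b) * (a * b) = (1 + p * s) * (1 + p * s) + (s - p) * (s - p)).
  { replace ((a * b) * (a * b)) with ((a * a) * (b * b)) by ring.
    rewrite Ha, Hb; ring. }
  assert (HC : 1 + p * s <= a * b).
  { apply Rnot_lt_le; intros h; assert (0 <= (s - p) * (s - p)) by apply Rle_0_sqr; nra. }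
  assert (HD0 : 0 <= D).
  { apply Rmult_le_reg_l with b; lra. }
  (* With [c = 1 + p * s], the square [(s - p)^2] factors as [(ab - c)(ab + c)], and [c <= ab]. *)
  assert (Hm : (s - p) * (s - p) <= 2 * (a * b) * (b * D)).
  { rewrite HD; nra. }
  assert (HC0 : 0 <= (1 + 2 * K) ^ 3 / e).
  { apply Rdiv_le_0_compat; [apply pow_le; lra|lra]. }
  assert (HM1 : 0 <= Rmax 0 (Rabs s - K)) by apply Rmax_l.
  assert (HM2 : 0 <= Rmax 0 (Rabs p - K)) by apply Rmax_l.
  assert (HM3 : Rabs s - K <= Rmax 0 (Rabs s - K)) by apply Rmax_r.
  assert (HM4 : Rabs p - K <= Rmax 0 (Rabs p - K)) by apply Rmax_r.
  assert (HT : Rabs (s - p) <= Rabs s + Rabs p).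
  { unfold Rminus; rewrite <- (Rabs_Ropp p); apply Rabs_triang. }
  assert (HCD : 0 <= (1 + 2 * K) ^ 3 / e * D) by (apply Rmult_le_pos; auto).
  (* If both slopes are at most [2K], the divergence controls [(s - p)^2]. Otherwise the larger
     modulus [x] exceeds [2K], so [|s - p| <= 2x <= 4(x - K)]. *)
  destruct (Rle_dec (Rabs s) (2 * K)) as [h1|h1];
    [destruct (Rle_dec (Rabs p) (2 * K)) as [h2|h2]|].
  - assert (Hbd : forall x, Rabs x <= 2 * K -> sqrt (1 + x * x) <= 1 + 2 * K).
    { intros x Hx; rewrite <- (sqrt_square (1 + 2 * K)) by lra.
      apply sqrt_le_1_alt.
      assert (x * x = Rabs x * Rabs x) by (rewrite <- Rabs_mult; symmetry; apply Rabs_pos_eq, Rle_0_sqr).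
      generalize (Rabs_pos x); nra. }
    assert (ha : a <= 1 + 2 * K) by (apply Hbd; auto).
    assert (hb : b <= 1 + 2 * K) by (apply Hbd; auto).
    assert (H3 : a * b * b <= (1 + 2 * K) ^ 3).
    { replace ((1 + 2 * K) ^ 3) with ((1 + 2 * K) * (1 + 2 * K) * (1 + 2 * K)) by ring.
      apply Rmult_le_compat; nra. }
    assert (H4 : (s - p) * (s - p) <= 2 * (1 + 2 * K) ^ 3 * D).
    { apply Rle_trans with (1 := Hm).
      replace (2 * (a * b) * (b * D)) with (2 * (a * b * b) * D) by ring.
      apply Rmult_le_compat_r; lra. }
    assert (H5 : Rabs (s - p) <= e + (s - p) * (s - p) / (2 * e)).
    { apply Rmult_le_reg_l with (2 * e); [lra|].
      replace (2 * e * (e + (s - p) * (s - p) / (2 * e))) with (2 * e * e + (s - p) * (s - p))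
        by (field; lra).
      assert (Hx : (s - p) * (s - p) = Rabs (s - p) * Rabs (s - p)).
      { rewrite <- Rabs_mult; symmetry; apply Rabs_pos_eq, Rle_0_sqr. }
      rewrite Hx; nra. }
    assert (H6 : (s - p) * (s - p) / (2 * e) <= (1 + 2 * K) ^ 3 / e * D).
    { apply Rmult_le_reg_l with (2 * e); [lra|].
      replace (2 * e * ((s - p) * (s - p) / (2 * e))) with ((s - p) * (s - p)) by (field; lra).
      replace (2 * e * ((1 + 2 * K) ^ 3 / e * D)) with (2 * (1 + 2 * K) ^ 3 * D) by (field; lra).
      exact H4. }
    lra.
  - destruct (Rle_dec (Rabs s) (Rabs p)); lra.
  - destruct (Rle_dec (Rabs s) (Rabs p)); lra.
Qed.

(** This is [bregman_bound] for the slope [s] of [f] on [[u,v]], multiplied by [v - u]; an interval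
    reduced to a point is treated apart. *)
Lemma piece_bound f K e p u v :
  0 <= K -> 0 < e -> u <= v ->
  Rabs (f v - f u - p * (v - u)) <= e * (v - u) + (1 + 2 * K) ^ 3 / e *
      (arc f u v - (v - u + p * (f v - f u)) / sqrt (1 + p * p))
    + 4 * excess f K u v + 4 * ((v - u) * Rmax 0 (Rabs p - K)).
Proof.
  intros HK He [Huv|Huv].
  - set (d := v - u); assert (Hd : 0 < d) by (unfold d; lra).
    set (s := (f v - f u) / d).
    assert (Hs : f v - f u = s * d) by (unfold s; field; lra).
    unfold arc, excess; fold d; rewrite Hs.
    replace (s * d - p * d) with (d * (s - p)) by ring.
    replace (d * d + s * d * (s * d)) with ((d * d) * (1 + s * s)) by ring.
    rewrite sqrt_mult_alt, sqrt_square, !Rabs_mult, (Rabs_pos_eq d) by nra.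
    replace (Rmax 0 (Rabs s * d - K * d)) with (d * Rmax 0 (Rabs s - K)).
    2: { rewrite <- RmaxRmult by lra; f_equal; ring. }
    assert (0 < sqrt (1 + p * p)) by (apply sqrt_lt_R0; nra).
    replace ((d + p * (s * d)) / sqrt (1 + p * p)) with (d * ((1 + p * s) / sqrt (1 + p * p)))
      by (field; lra).
    generalize (bregman_bound K e s p HK He); intros HB.
    apply Rmult_le_compat_l with (r := d) in HB; [|lra].
    eapply Rle_trans; [exact HB|]; apply Req_le; ring.
  - subst v; unfold arc, excess.
    replace (u - u) with 0 by ring; replace (f u - f u) with 0 by ring.
    rewrite !Rmult_0_r, !Rmult_0_l, !Rplus_0_l, Rminus_0_r, Rabs_R0, sqrt_0, Rmult_0_r.
    unfold Rdiv; rewrite Rmult_0_l, Rminus_0_r, Rmax_left by lra; lra.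
Qed.

(** The sum of [piece_bound] over the cell: since [p] is fixed, the terms linear in the increments
    telescope and only the end points remain in them. *)
Lemma cell_bound f K e p x l :
  0 <= K -> 0 < e -> wincr x l ->
  let y := endpt x l in
  psum (fun u v => Rabs (f v - f u - p * (v - u))) x l <=
    e * (y - x) + (1 + 2 * K) ^ 3 / e *
      (psum (arc f) x l - (y - x + p * (f y - f x)) / sqrt (1 + p * p))
    + 4 * psum (excess f K) x l + 4 * ((y - x) * Rmax 0 (Rabs p - K)).
Proof.
  intros HK He; revert x; induction l as [|z l IH]; intros x; simpl.
  - intros _; unfold Rdiv; rewrite !Rminus_diag; lra.
  - intros [Hxz Hl]; specialize (IH z Hl); simpl in IH.
    generalize (piece_bound f K e p x z HK He Hxz); intros H1.
    assert (0 < sqrt (1 + p * p)) by (apply sqrt_lt_R0; nra).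
    eapply Rle_trans; [apply Rplus_le_compat; [exact H1|exact IH]|].
    apply Req_le; field; split; lra.
Qed.

(** When [p] is the slope of the chord, the subtracted term in [cell_bound] is the length of that
    chord, so the bracket there becomes the gain in arc length. *)
Lemma coarse_arc f a b :
  a <= b ->
  (b - a + slope f a b * (f b - f a)) / sqrt (1 + slope f a b * slope f a b) = arc f a b.
Proof.
  intros H; generalize (slope_mult f a b H); intros Hs.
  set (p := slope f a b) in *; unfold arc; rewrite <- Hs.
  assert (Hp : 0 < sqrt (1 + p * p)) by (apply sqrt_lt_R0; nra).
  replace ((b - a) * (b - a) + p * (b - a) * (p * (b - a)))
    with (((b - a) * (b - a)) * (1 + p * p)) by ring.
  rewrite sqrt_mult_alt, sqrt_square by nra.
  apply Rmult_eq_reg_r with (sqrt (1 + p * p)); [|lra].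
  rewrite (Rmult_assoc (b - a)), sqrt_sqrt by nra; field; lra.
Qed.

Lemma coarse_excess f K a b :
  a <= b -> (b - a) * Rmax 0 (Rabs (slope f a b) - K) = excess f K a b.
Proof.
  intros H; unfold excess; rewrite <- (slope_mult f a b H), <- RmaxRmult by lra.
  rewrite Rabs_mult, (Rabs_pos_eq (b - a)) by lra; f_equal; ring.
Qed.

(** The test partition [y0 :: l'] is projected onto each cell of [l]. The projections, joined
    together, form a refinement [r] of [l], and [cell_bound] applies in each cell with the coarse
    slope. *)
Lemma polygon_var_bound f K e x0 l y0 l' :
  0 <= K -> 0 < e -> wincr x0 l -> wincr y0 l' ->
  exists r, wincr x0 r /\ endpt x0 r = endpt x0 l /\
    var_sum (fun t => f (Rmax t x0) - polygon f x0 l t) y0 l' <=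
      e * (endpt x0 l - x0)
      + (1 + 2 * K) ^ 3 / e * (psum (arc f) x0 r - psum (arc f) x0 l)
      + 4 * psum (excess f K) x0 r + 4 * psum (excess f K) x0 l
      + var_sum (fun t => f (Rmax t (endpt x0 l))) y0 l'.
Proof.
  intros HK He; revert x0; induction l as [|x l IH]; intros x0 Hl Hl'.
  - exists nil; simpl; repeat split; try lra.
    apply Rle_trans with (var_sum (fun t => f (Rmax t x0)) y0 l' + var_sum (fun _ => 0) y0 l').
    + apply var_sum_triangle; intros u v.
      replace (f (Rmax v x0) - 0 - (f (Rmax u x0) - 0)) with (f (Rmax v x0) - f (Rmax u x0)) by ring.
      generalize (Rabs_pos (0 - 0)); lra.
    + assert (Hz : var_sum (fun _ => 0) y0 l' <= Rabs 0 * 0).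
      { apply (var_le_wincr (fun _ => 0)); auto.
        apply (var_le_scal _ (fun _ => 0) 0); [intros; ring|].
        intros z m _; revert z; induction m as [|z' m IHm]; simpl; intros z; [lra|].
        rewrite Rminus_diag, Rabs_R0, Rplus_0_l; auto. }
      lra.
  - destruct Hl as [Hx Hl]; destruct (IH x Hl Hl') as [r2 [Hr1 [Hr2 Hr3]]].
    set (psi := clamp x0 x).
    (* The final [x] closes the cell, which the projected test points need not reach. *)
    set (r1 := map psi (y0 :: l') ++ x :: nil).
    assert (Hr : wincr x0 r1).
    { apply wincr_app; simpl.
      - split; [apply clamp_bounds; auto|].
        apply wincr_map; auto; intros u v; apply clamp_mono.
      - split; [|auto]; rewrite endpt_map; apply clamp_bounds; auto. }
    assert (He1 : endpt x0 r1 = x) by (unfold r1; rewrite endpt_app; auto).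
    exists (r1 ++ r2); split; [|split].
    + apply wincr_app; [easy|now rewrite He1].
    + rewrite endpt_app, He1; exact Hr2.
    + set (p := slope f x0 x) in *.
      generalize (cell_bound f K e p x0 r1 HK He Hr); cbv zeta; rewrite He1; intros HC.
      generalize (coarse_arc f x0 x Hx) (coarse_excess f K x0 x Hx); fold p; intros E1 E2.
      rewrite E1, E2 in HC.
      rewrite !psum_app, He1; cbn [psum endpt polygon].
      (* Passing to [r1] only adds the nonnegative terms of its first and last intervals. *)
      assert (HS : var_sum (fun t => f (psi t) - p * psi t) y0 l' <=
                   psum (fun u v => Rabs (f v - f u - p * (v - u))) x0 r1).
      { unfold r1; rewrite psum_app; simpl; rewrite psum_map, var_sum_psum.
        set (A := psum _ y0 l'); set (B := psum _ y0 l').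
        assert (HAB : A = B).
        { unfold A, B; clear; revert y0; induction l' as [|z l' IH]; simpl; intros y0; [easy|].
          rewrite IH; f_equal; f_equal; ring. }
        rewrite HAB; clear HAB.
        assert (H0 := Rabs_pos (f (psi y0) - f x0 - p * (psi y0 - x0))).
        match goal with |- context [_ + (Rabs ?z + 0)] => assert (H1 := Rabs_pos z) end.
        lra. }
      match goal with |- ?L <= _ => apply Rle_trans with
       (var_sum (fun t => f (psi t) - p * psi t) y0 l' +
        var_sum (fun t => f (Rmax t x) - polygon f x l t) y0 l') end.
      { apply var_sum_triangle; intros u v.
        rewrite !(split_max f x0 x) by auto; fold (psi u) (psi v).
        eapply Rle_trans; [|apply Rabs_triang]; apply Req_le; f_equal; unfold p, psi; ring. }
      eapply Rle_trans; [apply Rplus_le_compat; [eapply Rle_trans; [exact HS|exact HC]|exact Hr3]|].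
      apply Req_le; ring.
Qed.

Fixpoint steep (f : R -> R) (K x0 : R) (l : list R) : list (R * R) :=
  match l with
  | nil => nil
  | x :: l' =>
      if Rlt_dec (K * (x - x0)) (Rabs (f x - f x0))
      then (x0, x) :: steep f K x l' else steep f K x l'
  end.

Lemma nonoverlap_weaken a b l : a <= b -> nonoverlap b l -> nonoverlap a l.
Proof. destruct l as [|[c d] l]; simpl; [easy|]; intros H [H1 [H2 H3]]; repeat split; auto; lra. Qed.

(** A Chebyshev argument: the steep intervals carry all the excess, and [K] times their total length
    is at most the variation of [f]. *)
Lemma steep_spec f K x0 l :
  0 <= K -> wincr x0 l ->
  nonoverlap x0 (steep f K x0 l) /\
  List.Forall (fun q => snd q <= endpt x0 l) (steep f K x0 l) /\
  K * len_sum (steep f K x0 l) <= osc_sum f (steep f K x0 l) /\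
  osc_sum f (steep f K x0 l) <= var_sum f x0 l /\
  psum (excess f K) x0 l <= osc_sum f (steep f K x0 l).
Proof.
  intros HK; revert x0; induction l as [|x l IH]; simpl; intros x0.
  - intros _; repeat split; auto; lra.
  - intros [Hx Hl]; destruct (IH x Hl) as [H1 [H2 [H3 [H4 H5]]]].
    generalize (Rabs_pos (f x - f x0)); intros HP.
    destruct Rlt_dec as [h|h]; simpl.
    + assert (Hlt : x0 < x).
      { destruct Hx as [Hx|Hx]; [easy|subst; exfalso; revert h].
        rewrite !Rminus_diag, Rabs_R0; lra. }
      assert (excess f K x0 x <= Rabs (f x - f x0)) by (apply Rmax_lub; nra).
      repeat split; auto; try lra.
      constructor; auto; simpl; now apply wincr_endpt.
    + assert (excess f K x0 x <= 0) by (apply Rmax_lub; lra).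
      repeat split; auto; try lra.
      now apply nonoverlap_weaken with x.
Qed.

Lemma AC_excess_small f V a b eps :
  var_le f V -> AC_on f a b -> 0 < eps ->
  exists K, 0 <= K /\ forall l, wincr a l -> endpt a l = b -> psum (excess f K) a l <= eps.
Proof.
  intros HV HAC Heps; destruct (HAC eps Heps) as [d [Hd HA]].
  assert (HV0 : 0 <= V) by now apply var_le_nonneg in HV.
  (* With this [K], the total length of the steep intervals is at most [V / K < d], so absolute
     continuity applies to them. *)
  set (K := (V + 1) / d).
  assert (HK : 0 < K) by (apply Rdiv_lt_0_compat; lra).
  exists K; split; [lra|]; intros l Hl Hb.
  destruct (steep_spec f K a l) as [H1 [H2 [H3 [H4 H5]]]]; auto; [lra|].
  rewrite Hb in H2.
  assert (H6 := var_le_wincr f V a l HV Hl).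
  assert (len_sum (steep f K a l) < d).
  { apply Rmult_lt_reg_l with K; auto.
    replace (K * d) with (V + 1) by (unfold K; field; lra); lra. }
  specialize (HA _ H1 H2 H); lra.
Qed.

Lemma arc_sum_le f x l :
  wincr x l -> psum (arc f) x l <= endpt x l - x + var_sum f x l.
Proof.
  revert x; induction l as [|y l IH]; simpl; intros x; [lra|].
  intros [H1 H2]; specialize (IH y H2).
  assert (arc f x y <= (y - x) + Rabs (f y - f x)); [|lra].
  generalize (Rabs_pos (f y - f x)); intros HP.
  unfold arc; rewrite <- (sqrt_square (y - x + Rabs (f y - f x))) by lra.
  apply sqrt_le_1_alt.
  assert (Hx : (f y - f x) * (f y - f x) = Rabs (f y - f x) * Rabs (f y - f x)).
  { rewrite <- Rabs_mult; symmetry; apply Rabs_pos_eq, Rle_0_sqr. }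
  rewrite Hx; nra.
Qed.

(** A partition of almost maximal variation leaves less than [eps] for points added before its first
    point or after its last one. *)
Lemma BV_tails f eps :
  BV f -> 0 < eps ->
  exists a b, a < b /\ var_le (fun t => f (Rmin t a)) eps /\ var_le (fun t => f (Rmax t b)) eps.
Proof.
  intros [V HV] Heps.
  destruct (lub_approx (fun r => exists x l, wincr x l /\ r = var_sum f x l) V 0 eps)
    as [s [r [[x [l [Hl Hr]]] [Hs1 Hs2]]]]; auto.
  - exists 0, nil; simpl; auto.
  - intros r [x [l [Hl Hr]]]; subst; now apply var_le_wincr.
  (* The shift by 1 ensures [a < b] even if the partition is a single point. *)
  - exists x, (endpt x l + 1); split; [|split].
    + generalize (wincr_endpt x l Hl); lra.
    + intros y l' Hl'; apply incr_wincr in Hl'.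
      set (psi := fun t => Rmin t x).
      assert (H : var_sum f (psi y) (map psi l' ++ x :: l) <= s).
      { apply Hs2; exists (psi y), (map psi l' ++ x :: l); split; auto.
        apply wincr_app.
        - apply wincr_map; auto; intros u v; apply Rle_min_compat_r.
        - rewrite endpt_map; simpl; split; auto; apply Rmin_r. }
      rewrite var_sum_psum, psum_app, psum_map in H; simpl in H.
      rewrite var_sum_psum in Hr.
      rewrite var_sum_psum; unfold psi in H.
      match type of H with _ + (Rabs ?z + _) <= _ => generalize (Rabs_pos z) end.
      lra.
    + intros y l' Hl'; apply incr_wincr in Hl'.
      set (b := endpt x l + 1); set (psi := fun t => Rmax t b).
      assert (H : var_sum f x (l ++ psi y :: map psi l') <= s).
      { apply Hs2; exists x, (l ++ psi y :: map psi l'); split; auto.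
        apply wincr_app; auto; simpl; split.
        - apply Rle_trans with b; [unfold b; lra|apply Rmax_r].
        - apply wincr_map; auto; intros u v; apply Rle_max_compat_r. }
      rewrite var_sum_psum, psum_app in H; simpl in H; rewrite psum_map in H.
      rewrite var_sum_psum in Hr.
      rewrite var_sum_psum; unfold psi in H.
      match type of H with _ + (Rabs ?z + _) <= _ => generalize (Rabs_pos z) end.
      lra.
Qed.

Lemma AC_polygon_approx f eps :
  AC f -> 0 < eps ->
  exists x l, wincr x l /\ var_le (fun t => f t - polygon f x l t) eps.
Proof.
  intros [HBV HAC] Heps.
  destruct (BV_tails f (eps / 8) HBV) as [a [b [Hab [Ha Hb]]]]; [lra|].
  destruct HBV as [V HV].
  (* The excess enters twice with factor 4, hence [eps / 32]. The linear term, the gain in arc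
     length and each tail get [eps / 8]. *)
  destruct (AC_excess_small f V a b (eps / 32) HV (HAC a b Hab)) as [K [HK HU]]; [lra|].
  set (e := eps / (8 * (b - a))).
  assert (He : 0 < e) by (apply Rdiv_lt_0_compat; lra).
  set (C := (1 + 2 * K) ^ 3 / e).
  assert (HC : 0 < C) by (apply Rdiv_lt_0_compat; [apply pow_lt; lra|lra]).
  (* The nodes are those of an inscribed polygon on [[a,b]] of almost maximal length; no refinement
     gains more than [eps / (8 * C)]. *)
  destruct (lub_approx (fun r => exists l, wincr a l /\ endpt a l = b /\ r = psum (arc f) a l)
     (b - a + V) (psum (arc f) a (b :: nil)) (eps / (8 * C)))
    as [s [r [[l [Hl [Hlb Hr]]] [Hs1 Hs2]]]].
  - exists (b :: nil); simpl; repeat split; lra.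
  - intros r [l [Hl [Hlb Hr]]]; subst r.
    generalize (arc_sum_le f a l Hl) (var_le_wincr f V a l HV Hl); rewrite Hlb; lra.
  - apply Rdiv_lt_0_compat; lra.
  - exists a, l; split; [easy|].
    apply var_le_weaken with (eps / 8 + 7 * eps / 8); [lra|].
    apply var_le_sum with (fun t => f (Rmin t a)) (fun t => f (Rmax t a) - polygon f a l t); auto.
    { intros u v; rewrite (split_min_max f a u), (split_min_max f a v); ring. }
    intros y l' Hl'.
    specialize (Hb y l' Hl'); apply incr_wincr in Hl'.
    destruct (polygon_var_bound f K e a l y l' HK He Hl Hl') as [q [Hq1 [Hq2 Hq3]]].
    fold C in Hq3; rewrite Hlb in *.
    assert (H1 : psum (arc f) a q <= s) by (apply Hs2; eauto).
    assert (H2 := HU l Hl Hlb); assert (H3 := HU q Hq1 Hq2).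
    assert (H4 : C * (psum (arc f) a q - psum (arc f) a l) <= eps / 8).
    { replace (eps / 8) with (C * (eps / (8 * C))) by (field; lra).
      apply Rmult_le_compat_l; lra. }
    assert (H5 : e * (b - a) = eps / 8) by (unfold e; field; lra).
    lra.
Qed.

(** * Two-sided series *)

Fixpoint zsum (a : Z -> R) (z : Z) (n : nat) : R :=
  match n with O => 0 | S n' => a z + zsum a (z + 1)%Z n' end.

(** Partial sums run over arbitrary integer windows containing [[-N,N]], a form of two-sided
    convergence that is visibly stable under shifts of the index. *)
Definition zcv (a : Z -> R) (l : R) : Prop :=
  forall eps, 0 < eps -> exists N : nat, forall (z : Z) (n : nat),
    (z <= - Z.of_nat N)%Z -> (Z.of_nat N < z + Z.of_nat n)%Z ->
    Rabs (zsum a z n - l) < eps.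

Lemma zsum_ext a b z n :
  (forall k, (z <= k < z + Z.of_nat n)%Z -> a k = b k) -> zsum a z n = zsum b z n.
Proof.
  revert z; induction n as [|n IH]; intros z H; cbn [zsum]; [easy|].
  rewrite H, IH by lia || (intros; apply H; lia); easy.
Qed.

Lemma zsum_le a b z n :
  (forall k, (z <= k < z + Z.of_nat n)%Z -> a k <= b k) -> zsum a z n <= zsum b z n.
Proof.
  revert z; induction n as [|n IH]; intros z H; cbn [zsum]; [lra|].
  apply Rplus_le_compat; [apply H; lia|apply IH; intros; apply H; lia].
Qed.

Lemma zsum_plus a b z n : zsum (fun k => a k + b k) z n = zsum a z n + zsum b z n.
Proof. revert z; induction n as [|n IH]; intros z; cbn [zsum]; [ring|rewrite IH; ring]. Qed.

Lemma zsum_scal c a z n : zsum (fun k => c * a k) z n = c * zsum a z n.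
Proof. revert z; induction n as [|n IH]; intros z; cbn [zsum]; [ring|rewrite IH; ring]. Qed.

Lemma zsum_minus a b z n : zsum (fun k => a k - b k) z n = zsum a z n - zsum b z n.
Proof. revert z; induction n as [|n IH]; intros z; cbn [zsum]; [ring|rewrite IH; ring]. Qed.

Lemma zsum_abs a z n : Rabs (zsum a z n) <= zsum (fun k => Rabs (a k)) z n.
Proof.
  revert z; induction n as [|n IH]; intros z; cbn [zsum]; [rewrite Rabs_R0; lra|].
  eapply Rle_trans; [apply Rabs_triang|]; specialize (IH (z + 1)%Z); lra.
Qed.

Lemma zsum_nonneg a z n : (forall k, 0 <= a k) -> 0 <= zsum a z n.
Proof.
  intros H; revert z; induction n as [|n IH]; intros z; cbn [zsum]; [lra|].
  specialize (H z); specialize (IH (z + 1)%Z); lra.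
Qed.

Lemma zsum_shift a c z n : zsum (fun k => a (k + c)%Z) z n = zsum a (z + c) n.
Proof.
  revert z; induction n as [|n IH]; intros z; cbn [zsum]; [easy|].
  rewrite IH; do 2 f_equal; lia.
Qed.

Lemma zsum_app a z n n' :
  zsum a z (n + n') = zsum a z n + zsum a (z + Z.of_nat n) n'.
Proof.
  revert z; induction n as [|n IH]; intros z; cbn [zsum Nat.add].
  - rewrite Z.add_0_r; ring.
  - rewrite IH; replace (z + 1 + Z.of_nat n)%Z with (z + Z.of_nat (S n))%Z by lia; ring.
Qed.

(** The lengths [i] and [j] are chosen before [a], so one splitting serves both a series and the
    series of its absolute values. *)
Lemma zsum_window z n z' n' :
  (z' <= z)%Z -> (z + Z.of_nat n <= z' + Z.of_nat n')%Z ->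
  exists i j : nat, (z' + Z.of_nat i = z)%Z /\
    forall a, zsum a z' n' = zsum a z' i + zsum a z n + zsum a (z + Z.of_nat n) j.
Proof.
  intros H1 H2.
  exists (Z.to_nat (z - z')), (Z.to_nat (z' + Z.of_nat n' - z - Z.of_nat n)).
  split; [lia|]; intros a.
  replace n' with (Z.to_nat (z - z') + (n + Z.to_nat (z' + Z.of_nat n' - z - Z.of_nat n)))%nat
    at 1 by lia.
  rewrite !zsum_app.
  replace (z' + Z.of_nat (Z.to_nat (z - z')))%Z with z by lia; ring.
Qed.

Lemma zsum_window_le a z n z' n' :
  (forall k, 0 <= a k) -> (z' <= z)%Z -> (z + Z.of_nat n <= z' + Z.of_nat n')%Z ->
  zsum a z n <= zsum a z' n'.
Proof.
  intros Ha H1 H2; destruct (zsum_window z n z' n' H1 H2) as [i [j [_ H]]].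
  rewrite H; generalize (zsum_nonneg a z' i Ha) (zsum_nonneg a (z + Z.of_nat n) j Ha); lra.
Qed.

Lemma Zrange_zsum a p q : Zrange a p q = zsum a (- Z.of_nat p) (S (p + q)).
Proof.
  unfold Zrange; set (n := (p + q)%nat); clearbody n; induction n as [|n IH].
  - cbn [sum_f_R0 zsum]; rewrite Rplus_0_r; f_equal; lia.
    replace (S (S n)) with (S n + 1)%nat by lia.
    rewrite zsum_app; cbn [sum_f_R0]; rewrite IH; cbn [zsum].
    rewrite Rplus_0_r; do 2 f_equal; lia.
Qed.

Lemma Zseries_cv_zcv a l : Zseries_cv a l <-> zcv a l.
Proof.
  split; intros H eps Heps; destruct (H eps Heps) as [N HN]; exists N.
  - intros z n H1 H2; specialize (HN (Z.to_nat (- z)) (Z.to_nat (z + Z.of_nat n - 1))).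
    rewrite Zrange_zsum in HN.
    replace (- Z.of_nat (Z.to_nat (- z)))%Z with z in HN by lia.
    replace (S (Z.to_nat (- z) + Z.to_nat (z + Z.of_nat n - 1))) with n in HN by lia.
    apply HN; lia.
  - intros p q H1 H2; rewrite Zrange_zsum; apply HN; lia.
Qed.

Lemma zcv_ext a b l : (forall k, a k = b k) -> zcv a l -> zcv b l.
Proof.
  intros H Ha eps Heps; destruct (Ha eps Heps) as [N HN]; exists N; intros z n H1 H2.
  rewrite <- (zsum_ext a b) by auto; auto.
Qed.

Lemma zcv_plus a b l l' : zcv a l -> zcv b l' -> zcv (fun k => a k + b k) (l + l').
Proof.
  intros Ha Hb eps Heps.
  destruct (Ha (eps / 2)) as [N1 H1]; [lra|]; destruct (Hb (eps / 2)) as [N2 H2]; [lra|].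
  exists (max N1 N2); intros z n h1 h2; rewrite zsum_plus.
  specialize (H1 z n ltac:(lia) ltac:(lia)); specialize (H2 z n ltac:(lia) ltac:(lia)).
  replace (zsum a z n + zsum b z n - (l + l')) with ((zsum a z n - l) + (zsum b z n - l')) by ring.
  eapply Rle_lt_trans; [apply Rabs_triang|lra].
Qed.

Lemma zcv_scal c a l : zcv a l -> zcv (fun k => c * a k) (c * l).
Proof.
  intros Ha eps Heps; generalize (Rabs_pos c); intros Hc.
  destruct (Ha (eps / (Rabs c + 1))) as [N H]; [apply Rdiv_lt_0_compat; lra|].
  exists N; intros z n h1 h2; specialize (H z n h1 h2).
  rewrite zsum_scal, <- Rmult_minus_distr_l, Rabs_mult.
  apply Rle_lt_trans with (Rabs c * (eps / (Rabs c + 1))).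
  - apply Rmult_le_compat_l; lra.
  - apply Rmult_lt_reg_r with (Rabs c + 1); [lra|].
    replace (Rabs c * (eps / (Rabs c + 1)) * (Rabs c + 1)) with (Rabs c * eps) by (field; lra).
    nra.
Qed.

Lemma zcv_minus a b l l' : zcv a l -> zcv b l' -> zcv (fun k => a k - b k) (l - l').
Proof.
  intros Ha Hb; replace (l - l') with (l + (-1) * l') by ring.
  apply zcv_ext with (fun k => a k + (-1) * b k); [intros; ring|].
  apply zcv_plus; [easy|now apply zcv_scal].
Qed.

Lemma zcv_unique a l l' : zcv a l -> zcv a l' -> l = l'.
Proof.
  intros H1 H2; apply cond_eq; intros eps Heps.
  destruct (H1 (eps / 2)) as [N1 h1]; [lra|]; destruct (H2 (eps / 2)) as [N2 h2]; [lra|].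
  set (N := max N1 N2).
  specialize (h1 (- Z.of_nat N)%Z (S (N + N)) ltac:(lia) ltac:(lia)).
  specialize (h2 (- Z.of_nat N)%Z (S (N + N)) ltac:(lia) ltac:(lia)).
  rewrite Rabs_minus_sym in h1.
  replace (l - l') with ((l - zsum a (- Z.of_nat N) (S (N + N))) +
     (zsum a (- Z.of_nat N) (S (N + N)) - l')) by ring.
  eapply Rle_lt_trans; [apply Rabs_triang|lra].
Qed.

Lemma zcv_shift a c l : zcv a l -> zcv (fun k => a (k + c)%Z) l.
Proof.
  intros H eps Heps; destruct (H eps Heps) as [N HN].
  exists (N + Z.abs_nat c)%nat; intros z n h1 h2; rewrite zsum_shift; apply HN; lia.
Qed.

(** A window whose absolute sum is almost maximal leaves less than [eps] for all terms outside it,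
    which gives a Cauchy criterion for windows. *)
Lemma zcv_abs a M :
  (forall z n, zsum (fun k => Rabs (a k)) z n <= M) -> exists l, zcv a l.
Proof.
  intros HM.
  assert (HA : forall eps, 0 < eps -> exists N : nat, forall z n,
    (z <= - Z.of_nat N)%Z -> (Z.of_nat N < z + Z.of_nat n)%Z ->
    Rabs (zsum a z n - zsum a (- Z.of_nat N) (S (N + N))) < eps).
  { intros eps Heps.
    destruct (lub_approx (fun r => exists z n, r = zsum (fun k => Rabs (a k)) z n) M
      (zsum (fun k => Rabs (a k)) 0 0) eps) as [s [r [[z0 [n0 Hr]] [Hs1 Hs2]]]]; eauto.
    { intros x [z [n Hx]]; subst; auto. }
    exists (Z.abs_nat z0 + n0)%nat; set (N := (Z.abs_nat z0 + n0)%nat); intros z n h1 h2.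
    destruct (zsum_window (- Z.of_nat N) (S (N + N)) z n) as [i [j [_ Hij]]]; [lia|lia|].
    rewrite Hij.
    assert (H1 := Hs2 _ (ex_intro _ z (ex_intro _ n eq_refl))); rewrite Hij in H1.
    assert (H2 : r <= zsum (fun k => Rabs (a k)) (- Z.of_nat N) (S (N + N))).
    { rewrite Hr; apply zsum_window_le; [intros; apply Rabs_pos|lia|lia]. }
    generalize (zsum_abs a z i) (zsum_abs a (- Z.of_nat N + Z.of_nat (S (N + N))) j).
    match goal with |- Rabs ?x <= _ -> Rabs ?y <= _ -> Rabs ?t < _ =>
      replace t with (x + y) by ring; generalize (Rabs_triang x y) end.
    lra. }
  (* The limit is found along symmetric windows; [HA] then extends it to all large windows. *)
  set (u := fun N => zsum a (- Z.of_nat N) (S (N + N))).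
  assert (HC : Cauchy_crit u).
  { intros eps Heps; destruct (HA (eps / 2)) as [N HN]; [lra|].
    exists N; intros p q Hp Hq; unfold R_dist.
    assert (H1 := HN (- Z.of_nat p)%Z (S (p + p)) ltac:(lia) ltac:(lia)).
    assert (H2 := HN (- Z.of_nat q)%Z (S (q + q)) ltac:(lia) ltac:(lia)).
    fold (u p) in H1; fold (u q) in H2; fold (u N) in H1, H2.
    rewrite Rabs_minus_sym in H2.
    replace (u p - u q) with ((u p - u N) + (u N - u q)) by ring.
    eapply Rle_lt_trans; [apply Rabs_triang|lra]. }
  destruct (Rcomplete.R_complete u HC) as [l Hl]; exists l; intros eps Heps.
  destruct (HA (eps / 3)) as [N HN]; [lra|].
  destruct (Hl (eps / 3)) as [N' HN']; [lra|].
  exists N; intros z n h1 h2.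
  set (q := max N N').
  specialize (HN' q ltac:(lia)); unfold R_dist in HN'.
  assert (H1 := HN z n h1 h2).
  assert (H2 := HN (- Z.of_nat q)%Z (S (q + q)) ltac:(lia) ltac:(lia)).
  fold (u N) in H1, H2; fold (u q) in H2; rewrite Rabs_minus_sym in H2.
  replace (zsum a z n - l) with ((zsum a z n - u N) + ((u N - u q) + (u q - l))) by ring.
  eapply Rle_lt_trans; [apply Rabs_triang|].
  apply Rle_lt_trans with (Rabs (zsum a z n - u N) + (Rabs (u N - u q) + Rabs (u q - l)));
    [apply Rplus_le_compat_l, Rabs_triang|lra].
Qed.

(** Existence of a limit is what makes the value chosen by [epsilon] the sum of the series. *)
Lemma Zseries_sum_zcv a M :
  (forall z n, zsum (fun k => Rabs (a k)) z n <= M) -> zcv a (Zseries_sum a).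
Proof.
  intros H; destruct (zcv_abs a M H) as [l Hl].
  apply Zseries_cv_zcv; unfold Zseries_sum; apply ClassicalEpsilon.epsilon_spec.
  exists l; now apply Zseries_cv_zcv.
Qed.

(** Lower semicontinuity of variation: a partition has finitely many increments, so one window
    approximates all of them at once. *)
Lemma var_sum_limit F (E : Z -> R -> R -> R) x0 l M N :
  (forall s t, zcv (fun k => E k s t) (F t - F s)) ->
  (forall z n, (z <= - Z.of_nat N)%Z -> (Z.of_nat N < z + Z.of_nat n)%Z ->
     psum (fun s t => Rabs (zsum (fun k => E k s t) z n)) x0 l <= M) ->
  var_sum F x0 l <= M.
Proof.
  intros HE HM.
  assert (H : forall eps, 0 < eps -> exists N' : nat, forall z n,
    (z <= - Z.of_nat N')%Z -> (Z.of_nat N' < z + Z.of_nat n)%Z ->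
    var_sum F x0 l <= psum (fun s t => Rabs (zsum (fun k => E k s t) z n)) x0 l + eps).
  { clear HM; revert x0; induction l as [|x l IH]; intros x0 eps Heps.
    - exists 0%nat; simpl; intros; lra.
    - destruct (IH x (eps / 2)) as [N1 H1]; [lra|].
      destruct (HE x0 x (eps / 2)) as [N2 H2]; [lra|].
      exists (max N1 N2); intros z n h1 h2; cbn [var_sum psum].
      specialize (H1 z n ltac:(lia) ltac:(lia)); specialize (H2 z n ltac:(lia) ltac:(lia)).
      rewrite Rabs_minus_sym in H2.
      generalize (Rabs_triang_inv (F x - F x0) (zsum (fun k => E k x0 x) z n)); lra. }
  apply Rnot_lt_le; intros h.
  destruct (H ((var_sum F x0 l - M) / 2)) as [N' HN']; [lra|].
  set (q := max N N').
  specialize (HN' (- Z.of_nat q)%Z (S (q + q)) ltac:(lia) ltac:(lia)).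
  specialize (HM (- Z.of_nat q)%Z (S (q + q)) ltac:(lia) ltac:(lia)).
  lra.
Qed.

Fixpoint zpoints (g : Z -> R) (z : Z) (n : nat) : list R :=
  match n with O => nil | S n' => g z :: zpoints g (z + 1)%Z n' end.

Lemma zsum_var f V (g : Z -> R) z n :
  var_le f V -> (forall k, g k <= g (k + 1)%Z) ->
  zsum (fun k => Rabs (f (g (k + 1)%Z) - f (g k))) z n <= V.
Proof.
  intros HV Hg.
  replace (zsum _ z n) with (var_sum f (g z) (zpoints g (z + 1) n)).
  - apply var_le_wincr; auto.
    revert z; induction n as [|n IH]; intros z; cbn; auto.
  - revert z; induction n as [|n IH]; intros z; cbn [zpoints zsum var_sum]; [easy|].
    now rewrite IH.
Qed.

(** An increment over [m] steps is a sum of [m] unit increments, each giving a shifted sum bounded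
    by [V]. *)
Lemma zsum_abs_diff (a : Z -> R) V m z n :
  (forall z n, zsum (fun k => Rabs (a (k + 1)%Z - a k)) z n <= V) ->
  zsum (fun k => Rabs (a (k + Z.of_nat m)%Z - a k)) z n <= INR m * V.
Proof.
  intros H; induction m as [|m IH].
  - rewrite (zsum_ext _ (fun _ => 0 * 0)), zsum_scal; [simpl; lra|].
    intros k _; cbn; rewrite Z.add_0_r, Rminus_diag, Rabs_R0; ring.
  - rewrite S_INR.
    apply Rle_trans with (zsum (fun k => Rabs (a (k + Z.of_nat m)%Z - a k)) z n +
      zsum (fun k => Rabs (a (k + 1)%Z - a k)) (z + Z.of_nat m) n).
    + rewrite <- (zsum_shift (fun k => Rabs (a (k + 1)%Z - a k))), <- zsum_plus.
      apply zsum_le; intros k _.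
      replace (k + Z.of_nat m + 1)%Z with (k + Z.of_nat (S m))%Z by lia.
      rewrite Rplus_comm; eapply Rle_trans; [|apply Rabs_triang]; apply Req_le; f_equal; ring.
    + specialize (H (z + Z.of_nat m)%Z n); lra.
Qed.

(** * Primitives and discrete sums of the kernel *)

(** Here [Q] stands for a primitive of [|chi|] and [M] for a bound of its integral; only domination
    of [P] and total mass are recorded. *)
Definition primitives (chi P Q : R -> R) (M : R) : Prop :=
  (forall x, is_derive P x (chi x)) /\
  (forall x y, x <= y -> Rabs (P y - P x) <= Q y - Q x) /\
  (forall x y, x <= y -> 0 <= Q y - Q x <= M).

Lemma kernel_primitives chi :
  continuity chi -> L1_cont chi -> exists P Q M, primitives chi P Q M.
Proof.
  intros Hc [M HM].
  assert (Hcc : forall x, continuous chi x) by (intros x; apply continuity_pt_filterlim, Hc).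
  assert (Hca : forall x, continuous (fun t => Rabs (chi t)) x)
    by (intros x; apply (continuous_comp chi Rabs); [auto|apply continuous_Rabs]).
  assert (Hi : forall a b, ex_RInt chi a b) by (intros; apply (ex_RInt_continuous (V := R_CompleteNormedModule)); auto).
  assert (Hia : forall a b, ex_RInt (fun t => Rabs (chi t)) a b)
    by (intros; apply (ex_RInt_continuous (V := R_CompleteNormedModule)); auto).
  assert (HD : forall g, (forall a b, ex_RInt g a b) -> forall x y : R,
     RInt g 0 y - RInt g 0 x = RInt g x y).
  { intros g Hg x y; rewrite <- (RInt_Chasles g 0 x y) by auto; unfold plus; simpl; ring. }
  exists (fun x => RInt chi 0 x), (fun x => RInt (fun t => Rabs (chi t)) 0 x), M.
  split; [|split].
  - intros x; apply (is_derive_RInt chi _ 0); [|auto].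
    exists (mkposreal 1 Rlt_0_1); intros y _; exact (RInt_correct chi 0 y (Hi 0 y)).
  - intros x y Hxy; rewrite !HD by auto; apply abs_RInt_le; auto.
  - intros x y Hxy; rewrite HD by auto; split.
    { apply RInt_ge_0; auto; intros; apply Rabs_pos. }
    rewrite (RInt_Reals _ _ _ (ex_RInt_Reals_0 _ _ _ (Hia x y))); auto.
Qed.

Lemma chibar_primitive chi P m t :
  continuity chi -> (forall x, is_derive P x (chi x)) ->
  chibar chi m t = (P (t + INR m / 2) - P (t - INR m / 2)) / INR m.
Proof.
  intros Hc HP; unfold chibar, Rdiv; rewrite Rmult_comm; f_equal.
  assert (HI : is_RInt (fun v => chi (t + v)) (- (INR m / 2)) (INR m / 2)
     (P (t + INR m / 2) - P (t - INR m / 2))).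
  { apply (is_RInt_derive (V := R_CompleteNormedModule) (fun v => P (t + v))).
    - intros x _; apply (is_derive_ext (fun v => P (t + v))); [easy|].
      evar_last; [apply (is_derive_comp P (fun v => t + v)); [apply HP|auto_derive; [easy|reflexivity]]|].
      unfold scal; simpl; unfold mult; simpl; ring.
    - intros x _; apply continuity_pt_filterlim.
      apply (continuity_pt_comp (fun v => t + v) chi); [|apply Hc].
      apply derivable_continuous_pt; reg. }
  unfold Defs.RInt.
  (* Integrability makes the chosen value of the integral the genuine one. *)
  match goal with |- ClassicalEpsilon.epsilon ?i ?p = _ =>
    assert (HE : p (ClassicalEpsilon.epsilon i p)) end.
  { apply ClassicalEpsilon.epsilon_spec.
    assert (pr : Riemann_integrable (fun v => chi (t + v)) (- (INR m / 2)) (INR m / 2))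
      by (apply ex_RInt_Reals_0; eexists; exact HI).
    exists (RiemannInt pr), pr; easy. }
  destruct HE as [pr Hpr]; rewrite <- Hpr, <- RInt_Reals; now apply is_RInt_unique.
Qed.

(** An interval carrying almost all the mass of [Q] leaves at most [eps] for any interval on one
    side of it. *)
Lemma primitive_tail (Q : R -> R) M eps :
  (forall x y, x <= y -> 0 <= Q y - Q x <= M) -> 0 < eps ->
  exists r, 0 < r /\ forall x y, x <= y -> y <= - r \/ r <= x -> Q y - Q x <= eps.
Proof.
  intros HQ Heps.
  destruct (lub_approx (fun d => exists x y, x <= y /\ d = Q y - Q x) M 0 eps)
    as [s [d [[x [y [Hxy Hd]]] [Hs1 Hs2]]]]; auto.
  { exists 0, 0; lra. }
  { intros d [x [y [Hxy Hd]]]; subst; now apply HQ. }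
  exists (1 + Rabs x + Rabs y); generalize (Rabs_pos x) (Rabs_pos y); intros.
  split; [lra|]; intros x' y' Hxy' [h|h].
  - assert (y' <= x) by (generalize (Rle_abs (- x)); rewrite Rabs_Ropp; lra).
    assert (H2 : Q y - Q x' <= s) by (apply Hs2; exists x', y; split; [lra|easy]).
    generalize (HQ y' x H1); lra.
  - assert (y <= x') by (generalize (Rle_abs y); lra).
    assert (H2 : Q y' - Q x <= s) by (apply Hs2; exists x, y'; split; [lra|easy]).
    generalize (HQ y x' H1); lra.
Qed.

(** Convergence on the compact set [[u,u]] suffices, since [sigma] is bounded uniformly; the added 1
    absorbs the distance from a partial sum to [sigma u]. *)
Lemma kernel_sum_bound chi :
  chi2 chi -> exists M, 0 <= M /\ forall u z n, zsum (fun k => Rabs (chi (u - IZR k))) z n <= M.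
Proof.
  intros [sigma [H1 [M HM]]].
  assert (H : forall u z n, zsum (fun k => Rabs (chi (u - IZR k))) z n <= M + 1).
  { intros u z n; destruct (H1 u u 1) as [N HN]; [lra|lra|].
    set (q := (N + n + Z.abs_nat z)%nat).
    specialize (HN q q ltac:(lia) ltac:(lia) u ltac:(lra)); rewrite Zrange_zsum in HN.
    apply Rle_trans with (zsum (fun k => Rabs (chi (u - IZR k))) (- Z.of_nat q) (S (q + q))).
    - apply zsum_window_le; [intros; apply Rabs_pos|lia|lia].
    - apply Rabs_def2 in HN; specialize (HM u); lra. }
  exists (M + 1); split; [|easy]; exact (H 0 0%Z 0%nat).
Qed.

Definition far (chi : R -> R) (r u : R) (k : Z) : R :=
  if Rle_dec (Rabs (u - IZR k)) r then 0 else Rabs (chi (u - IZR k)).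

Lemma far_nonneg chi r u k : 0 <= far chi r u k.
Proof. unfold far; destruct Rle_dec; [lra|apply Rabs_pos]. Qed.

Lemma far_le chi r u k : far chi r u k <= Rabs (chi (u - IZR k)).
Proof. unfold far; destruct Rle_dec; [apply Rabs_pos|lra]. Qed.

(* Uniform convergence on [0,1] suffices: integer translations of [u] only
   reindex the series. *)
Lemma kernel_sum_tail chi eps :
  chi2 chi -> 0 < eps ->
  exists r, 0 < r /\ forall u z n, zsum (far chi r u) z n <= eps.
Proof.
  intros [sigma [H1 _]] Heps.
  destruct (H1 0 1 (eps / 2)) as [N HN]; [lra|lra|].
  (* For [v] in [[0,1]] and [|k| <= N] one has [|v - k| <= N + 1], so the central window contributes
     nothing to [far]. *)
  exists (INR N + 1); split; [generalize (pos_INR N); lra|]; intros u z n.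
  set (c := Int_part u); set (v := u - IZR c).
  assert (Hv : 0 <= v <= 1) by (generalize (base_Int_part u); unfold v, c; lra).
  assert (Hsh : zsum (far chi (INR N + 1) u) z n = zsum (far chi (INR N + 1) v) (z - c) n).
  { replace z with (z - c + c)%Z at 1 by lia; rewrite <- zsum_shift.
    apply zsum_ext; intros k _; unfold far.
    replace (u - IZR (k + c)) with (v - IZR k) by (unfold v; rewrite plus_IZR; ring); easy. }
  rewrite Hsh; set (z1 := (z - c)%Z).
  set (q := (N + n + Z.abs_nat z1)%nat).
  apply Rle_trans with (zsum (far chi (INR N + 1) v) (- Z.of_nat q) (S (q + q))).
  { apply zsum_window_le; [apply far_nonneg|lia|lia]. }
  destruct (zsum_window (- Z.of_nat N) (S (N + N)) (- Z.of_nat q) (S (q + q)))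
    as [i [j [_ Hij]]]; [lia|lia|].
  assert (h1 := HN q q ltac:(lia) ltac:(lia) v Hv).
  assert (h2 := HN N N ltac:(lia) ltac:(lia) v Hv).
  rewrite Zrange_zsum in h1, h2; rewrite Hij in h1; rewrite Hij.
  assert (h3 : zsum (far chi (INR N + 1) v) (- Z.of_nat N) (S (N + N)) <= 0).
  { rewrite <- (Rmult_0_l (zsum (fun _ => 0) (- Z.of_nat N) (S (N + N)))), <- zsum_scal.
    apply zsum_le; intros k Hk; unfold far; destruct Rle_dec as [h|h]; [lra|].
    exfalso; apply h; apply Rabs_le; rewrite INR_IZR_INZ.
    assert (IZR (- Z.of_nat N) <= IZR k <= IZR (Z.of_nat N)) as [h3 h4]
      by (split; apply IZR_le; lia).
    rewrite opp_IZR in h3; lra. }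
  assert (h4 : forall z n, zsum (far chi (INR N + 1) v) z n <=
            zsum (fun k => Rabs (chi (v - IZR k))) z n)
    by (intros; apply zsum_le; intros; apply far_le).
  assert (h5 := h4 (- Z.of_nat q)%Z i).
  assert (h6 := h4 (- Z.of_nat N + Z.of_nat (S (N + N)))%Z j).
  apply Rabs_def2 in h1; apply Rabs_def2 in h2; lra.
Qed.

(** The weights [q] will be difference quotients of a truncation. Four errors of [eps / 4] occur:
    one from a large window, one from each side of the given window, and one from replacing [q] by
    1. *)
Lemma kernel_sum_near_one chi eps :
  chi1 chi -> chi2 chi -> 0 < eps ->
  exists r, 0 < r /\ forall u (q : Z -> R) z n,
    (forall k, 0 <= q k <= 1) -> (forall k, Rabs (u - IZR k) <= r -> q k = 1) ->
    (forall k, Rabs (u - IZR k) <= r -> (z <= k < z + Z.of_nat n)%Z) ->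
    Rabs (zsum (fun k => q k * chi (u - IZR k)) z n - 1) <= eps.
Proof.
  intros [_ [_ Hone]] H2 Heps.
  destruct (kernel_sum_tail chi (eps / 4) H2) as [r [Hr HT]]; [lra|].
  exists r; split; [easy|]; intros u q z n Hq Hq1 Hw.
  set (a := fun k => chi (u - IZR k)).
  assert (Hcv : zcv a 1) by apply Zseries_cv_zcv, Hone.
  destruct (Hcv (eps / 4)) as [N HN]; [lra|].
  set (p := (N + n + Z.abs_nat z)%nat).
  specialize (HN (- Z.of_nat p)%Z (S (p + p)) ltac:(lia) ltac:(lia)).
  destruct (zsum_window z n (- Z.of_nat p) (S (p + p))) as [i [j [Hi Hij]]]; [lia|lia|].
  rewrite Hij in HN.
  assert (HB : forall z' n', (forall k, (z' <= k < z' + Z.of_nat n')%Z -> ~ (z <= k < z + Z.of_nat n)%Z) ->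
     Rabs (zsum a z' n') <= eps / 4).
  { intros z' n' Hk; apply Rle_trans with (zsum (far chi r u) z' n'); [|auto].
    eapply Rle_trans; [apply zsum_abs|]; apply Req_le, zsum_ext; intros k Hk'.
    unfold far, a; destruct Rle_dec as [h|h]; [|easy].
    exfalso; apply (Hk k Hk'); auto. }
  assert (h1 := HB (- Z.of_nat p)%Z i ltac:(lia)).
  assert (h2 := HB (z + Z.of_nat n)%Z j ltac:(lia)).
  assert (h3 : Rabs (zsum (fun k => q k * a k) z n - zsum a z n) <= eps / 4).
  { rewrite <- zsum_minus; eapply Rle_trans; [apply zsum_abs|].
    apply Rle_trans with (zsum (far chi r u) z n); [|auto].
    apply zsum_le; intros k _; unfold far; destruct Rle_dec as [h|h].
    - rewrite Hq1 by easy; rewrite Rmult_1_l, Rminus_diag, Rabs_R0; lra.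
    - replace (q k * a k - a k) with ((q k - 1) * a k) by ring; rewrite Rabs_mult.
      fold (a k); rewrite <- (Rmult_1_l (Rabs (a k))) at 2.
      apply Rmult_le_compat_r; [apply Rabs_pos|].
      specialize (Hq k); apply Rabs_le; lra. }
  apply Rabs_le_between in h1; apply Rabs_le_between in h2.
  apply Rabs_le_between in h3; apply Rabs_def2 in HN.
  unfold a in *; apply Rabs_le; lra.
Qed.

(** The intervals [[c - k, c - k + d]] cover the line [d] times; for [d = 1] the sum telescopes. *)
Lemma zsum_overlap (Q : R -> R) M (c : R) d z n :
  (forall x y, x <= y -> 0 <= Q y - Q x <= M) ->
  zsum (fun k => Q (c - IZR k + INR d) - Q (c - IZR k)) z n <= INR d * M.
Proof.
  intros HQ; revert c; induction d as [|d IH]; intros c.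
  - rewrite (zsum_ext _ (fun _ => 0 * 0)), zsum_scal; [simpl; lra|].
    intros k _; simpl; rewrite Rplus_0_r; ring.
  - apply Rle_trans with (zsum (fun k => Q (c + 1 - IZR k + INR d) - Q (c + 1 - IZR k)) z n
       + zsum (fun k => Q (c + 1 - IZR k) - Q (c - IZR k)) z n).
    + rewrite <- zsum_plus; apply Req_le, zsum_ext; intros k _; rewrite S_INR.
      replace (c - IZR k + (INR d + 1)) with (c + 1 - IZR k + INR d) by ring; ring.
    + rewrite S_INR, Rmult_plus_distr_r, Rmult_1_l; apply Rplus_le_compat; [apply IH|].
      assert (HT : zsum (fun k => Q (c + 1 - IZR k) - Q (c - IZR k)) z n =
         Q (c + 1 - IZR z) - Q (c + 1 - IZR (z + Z.of_nat n))).
      { clear IH; revert z; induction n as [|n IHn]; intros z; cbn [zsum].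
        - rewrite Z.add_0_r; ring.
        - rewrite IHn; replace (z + 1 + Z.of_nat n)%Z with (z + Z.of_nat (S n))%Z by lia.
          rewrite (plus_IZR z 1); replace (c + 1 - (IZR z + 1)) with (c - IZR z) by ring; ring. }
      rewrite HT; apply HQ; rewrite plus_IZR, <- INR_IZR_INZ; generalize (pos_INR n); lra.
Qed.

(** This is the coefficient left by summation by parts; [w * dcoef f m w k] is the difference
    quotient of [f] over a step [m / w]. *)
Definition dcoef (f : R -> R) (m : nat) (w : R) (k : Z) : R :=
  (f (IZR (k + Z.of_nat m) / w) - f (IZR k / w)) / INR m.

Lemma dcoef_sum f V m w z n :
  var_le f V -> 0 < w -> (1 <= m)%nat ->
  zsum (fun k => Rabs (dcoef f m w k)) z n <= V.
Proof.
  intros HV Hw Hm.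
  assert (0 < INR m) by (apply lt_0_INR; lia).
  apply Rmult_le_reg_l with (INR m); [easy|]; rewrite <- zsum_scal.
  rewrite (zsum_ext _ (fun k => Rabs (f (IZR (k + Z.of_nat m) / w) - f (IZR k / w)))).
  - apply (zsum_abs_diff (fun k => f (IZR k / w))); intros z' n'.
    apply (zsum_var f V (fun k => IZR k / w)); [easy|].
    intros k; apply Rmult_le_compat_r; [apply Rlt_le, Rinv_0_lt_compat; lra|].
    apply IZR_le; lia.
  - intros k _; unfold dcoef, Rdiv; rewrite Rabs_mult, (Rabs_pos_eq (/ _)).
    + field; lra.
    + apply Rlt_le, Rinv_0_lt_compat; lra.
Qed.

(** * Increments of the sampling series *)

Lemma Sbar_zcv chi P Q M f B m w t :
  continuity chi -> primitives chi P Q M -> (1 <= m)%nat -> (forall x, Rabs (f x) <= B) ->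
  zcv (fun k => f (IZR k / w) * chibar chi m (w * t - IZR k)) (Sbar chi m w f t).
Proof.
  intros Hc [HP [HPQ HQ]] Hm HB.
  assert (Hm0 : 0 < INR m) by (apply lt_0_INR; lia).
  apply (Zseries_sum_zcv _ (B / INR m * (INR m * M))); intros z n.
  apply Rle_trans with (zsum (fun k => B / INR m *
    (Q (w * t - INR m / 2 - IZR k + INR m) - Q (w * t - INR m / 2 - IZR k))) z n).
  - apply zsum_le; intros k _.
    rewrite (chibar_primitive chi P) by easy.
    replace (w * t - IZR k + INR m / 2) with (w * t - INR m / 2 - IZR k + INR m) by field.
    replace (w * t - IZR k - INR m / 2) with (w * t - INR m / 2 - IZR k) by ring.
    set (y := w * t - INR m / 2 - IZR k).
    unfold Rdiv; rewrite !Rabs_mult, (Rabs_pos_eq (/ INR m))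
      by (apply Rlt_le, Rinv_0_lt_compat; easy).
    replace (B * / INR m * (Q (y + INR m) - Q y)) with (B * ((Q (y + INR m) - Q y) * / INR m)) by ring.
    apply Rmult_le_compat; [apply Rabs_pos| |apply HB|].
    + apply Rmult_le_pos; [apply Rabs_pos|apply Rlt_le, Rinv_0_lt_compat; easy].
    + apply Rmult_le_compat_r; [apply Rlt_le, Rinv_0_lt_compat; easy|apply HPQ; lra].
  - rewrite zsum_scal; apply Rmult_le_compat_l; [|now apply zsum_overlap].
    apply Rdiv_le_0_compat; [|easy].
    eapply Rle_trans; [apply Rabs_pos|apply (HB 0)].
Qed.

(* Summation by parts: the increments of [Sbar] only involve increments of [f]. *)
Lemma Sbar_increment chi P Q M f B m w s t :
  continuity chi -> primitives chi P Q M -> (1 <= m)%nat -> (forall x, Rabs (f x) <= B) ->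
  zcv (fun k => dcoef f m w k *
         (P (w * t - INR m / 2 - IZR k) - P (w * s - INR m / 2 - IZR k)))
      (Sbar chi m w f t - Sbar chi m w f s).
Proof.
  intros Hc Hpr Hm HB.
  assert (Hm0 : 0 < INR m) by (apply lt_0_INR; lia).
  assert (HS := fun t => Sbar_zcv chi P Q M f B m w t Hc Hpr Hm HB).
  destruct Hpr as [HP [HPQ HQ]].
  set (x := w * t - INR m / 2); set (y := w * s - INR m / 2).
  set (e := fun k => P (x - IZR k) - P (y - IZR k)).
  (* An integer length [d >= |x - y|] is needed to apply [zsum_overlap] to the intervals between
     [x - k] and [y - k]. *)
  set (c := Rmin x y); set (d := Z.to_nat (up (Rabs (x - y)))).
  assert (Hd : Rabs (x - y) <= INR d).
  { unfold d; rewrite INR_IZR_INZ; destruct (archimed (Rabs (x - y))) as [h _].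
    generalize (Rabs_pos (x - y)); intros h'.
    rewrite Z2Nat.id; [lra|]; apply le_IZR; lra. }
  assert (He : forall k, Rabs (e k) <= Q (c - IZR k + INR d) - Q (c - IZR k)).
  { intros k; unfold e.
    assert (h : Rabs (P (x - IZR k) - P (y - IZR k)) <= Q (Rmax x y - IZR k) - Q (c - IZR k)).
    { unfold c; destruct (Rle_dec x y) as [h|h].
      - rewrite Rmin_left, Rmax_right by lra; rewrite Rabs_minus_sym; apply HPQ; lra.
      - rewrite Rmin_right, Rmax_left by lra; apply HPQ; lra. }
    assert (h2 : Rmax x y - IZR k <= c - IZR k + INR d).
    { unfold c; destruct (Rle_dec x y) as [h'|h'].
      - rewrite Rmin_left, Rmax_right by lra; rewrite Rabs_minus_sym in Hd.
        generalize (Rle_abs (y - x)); lra.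
      - rewrite Rmin_right, Rmax_left by lra; generalize (Rle_abs (x - y)); lra. }
    generalize (HQ _ _ h2); lra. }
  assert (HB0 : 0 <= B) by (eapply Rle_trans; [apply Rabs_pos|apply (HB 0)]).
  assert (HE : exists l, zcv (fun k => f (IZR k / w) / INR m * e k) l).
  { apply (zcv_abs _ (B / INR m * (INR d * M))); intros z n.
    apply Rle_trans with (zsum (fun k => B / INR m * (Q (c - IZR k + INR d) - Q (c - IZR k))) z n).
    - apply zsum_le; intros k _; rewrite Rabs_mult.
      apply Rmult_le_compat; try apply Rabs_pos; [|apply He].
      unfold Rdiv; rewrite Rabs_mult, (Rabs_pos_eq (/ INR m))
        by (apply Rlt_le, Rinv_0_lt_compat; easy).
      apply Rmult_le_compat_r; [apply Rlt_le, Rinv_0_lt_compat; easy|apply HB].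
    - rewrite zsum_scal; apply Rmult_le_compat_l; [|now apply zsum_overlap].
      now apply Rdiv_le_0_compat. }
  destruct HE as [l Hl].
  (* The terms of the difference are [f(k/w) (e(k-m) - e(k)) / m]. Adding the auxiliary series
     leaves [f(k/w) e(k-m) / m]; a shift by [m] and a subtraction then give the coefficients
     [dcoef]. *)
  assert (HD := zcv_minus _ _ _ _ (HS t) (HS s)).
  assert (HF := zcv_plus _ _ _ _ HD Hl).
  assert (HG := zcv_minus _ _ _ _ (zcv_shift _ (Z.of_nat m) _ HF) Hl).
  replace (Sbar chi m w f t - Sbar chi m w f s)
    with (Sbar chi m w f t - Sbar chi m w f s + l - l) by ring.
  apply zcv_ext with (2 := HG); intros k; cbv beta.
  rewrite !(chibar_primitive chi P) by easy.
  unfold e, dcoef, x, y; rewrite plus_IZR, <- INR_IZR_INZ.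
  replace (w * t - (IZR k + INR m) + INR m / 2) with (w * t - INR m / 2 - IZR k) by field.
  replace (w * s - (IZR k + INR m) + INR m / 2) with (w * s - INR m / 2 - IZR k) by field.
  replace (w * t - (IZR k + INR m) - INR m / 2) with (w * t - INR m / 2 - (IZR k + INR m)) by ring.
  replace (w * s - (IZR k + INR m) - INR m / 2) with (w * s - INR m / 2 - (IZR k + INR m)) by ring.
  field; lra.
Qed.

Lemma BV_bounded f : BV f -> exists B, forall x, Rabs (f x) <= B.
Proof.
  intros [V HV]; exists (Rabs (f 0) + V); intros x.
  generalize (var_le_bounded f V 0 x HV) (Rabs_triang (f 0) (f x - f 0)).
  replace (f 0 + (f x - f 0)) with (f x) by ring; lra.
Qed.

(* Taking for [psi] a truncation bounds the variation of [Sbar] on an interval. *)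
Lemma Sbar_var_comp chi P Q M f V m w psi delta :
  continuity chi -> primitives chi P Q M -> (1 <= m)%nat -> 0 < w -> var_le f V ->
  0 <= delta -> (forall u v, u <= v -> psi u <= psi v) ->
  (forall k u v, dcoef f m w k <> 0 -> u <= v ->
     Q (w * psi v - INR m / 2 - IZR k) - Q (w * psi u - INR m / 2 - IZR k) <= delta) ->
  var_le (fun t => Sbar chi m w f (psi t)) (delta * V).
Proof.
  intros Hc Hpr Hm Hw HV Hd Hpsi HQd x0 l Hl; apply incr_wincr in Hl.
  destruct (BV_bounded f (ex_intro _ V HV)) as [B HB].
  apply (var_sum_limit _ (fun k s t => dcoef f m w k *
    (P (w * psi t - INR m / 2 - IZR k) - P (w * psi s - INR m / 2 - IZR k))) x0 l _ 0).
  { intros s t; now apply (Sbar_increment chi P Q M f B). }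
  intros z n _ _; destruct Hpr as [HP [HPQ HQ]].
  set (q := fun k t => Q (w * psi t - INR m / 2 - IZR k)).
  (* After exchanging the two sums, the increments of [q k] telescope along the partition for each
     [k]. *)
  assert (HT : psum (fun s t => Rabs (zsum (fun k => dcoef f m w k *
    (P (w * psi t - INR m / 2 - IZR k) - P (w * psi s - INR m / 2 - IZR k))) z n)) x0 l
     <= zsum (fun k => Rabs (dcoef f m w k) * (q k (endpt x0 l) - q k x0)) z n).
  { revert x0 Hl; induction l as [|x l IH]; intros x0 Hl; cbn [psum endpt].
    - apply zsum_nonneg; intros k; rewrite Rminus_diag; lra.
    - destruct Hl as [Hx Hl]; specialize (IH x Hl).
      rewrite (zsum_ext (fun k => Rabs (dcoef f m w k) * (q k (endpt x l) - q k x0))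
        (fun k => Rabs (dcoef f m w k) * (q k x - q k x0) +
                  Rabs (dcoef f m w k) * (q k (endpt x l) - q k x))) by (intros; ring).
      rewrite zsum_plus; apply Rplus_le_compat; [|exact IH].
      eapply Rle_trans; [apply zsum_abs|]; apply zsum_le; intros k _; rewrite Rabs_mult.
      apply Rmult_le_compat_l; [apply Rabs_pos|]; apply HPQ.
      assert (w * psi x0 <= w * psi x) by (apply Rmult_le_compat_l; [lra|auto]); lra. }
  eapply Rle_trans; [exact HT|].
  apply Rle_trans with (zsum (fun k => delta * Rabs (dcoef f m w k)) z n).
  - apply zsum_le; intros k _.
    destruct (Req_dec (dcoef f m w k) 0) as [h|h]; [rewrite h, Rabs_R0; lra|].
    rewrite Rmult_comm; apply Rmult_le_compat_r; [apply Rabs_pos|].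
    unfold q; apply HQd; [easy|]; now apply wincr_endpt.
  - rewrite zsum_scal; apply Rmult_le_compat_l; [easy|now apply dcoef_sum].
Qed.

Lemma Sbar_var chi P Q M f V m w :
  continuity chi -> primitives chi P Q M -> (1 <= m)%nat -> 0 < w -> var_le f V ->
  var_le (Sbar chi m w f) (M * V).
Proof.
  intros Hc Hpr Hm Hw HV; assert (HQ := proj2 (proj2 Hpr)).
  apply (Sbar_var_comp chi P Q M f V m w (fun t => t)); auto.
  - generalize (HQ 0 0 (Rle_refl 0)); lra.
  - intros k u v _ Huv; apply HQ.
    assert (w * u <= w * v) by (apply Rmult_le_compat_l; lra); lra.
Qed.

Lemma zsum_derive (c : Z -> R) chi P w b z n x :
  (forall y, is_derive P y (chi y)) ->
  is_derive (fun t => zsum (fun k => c k * P (w * t - b - IZR k)) z n) x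
            (zsum (fun k => w * c k * chi (w * x - b - IZR k)) z n).
Proof.
  intros HP; revert z; induction n as [|n IH]; intros z; cbn [zsum].
  - apply (is_derive_const (K := R_AbsRing) (V := R_NormedModule)).
  - apply (is_derive_plus (K := R_AbsRing) (V := R_NormedModule)); [|apply IH].
    replace (w * c z * chi (w * x - b - IZR z)) with (c z * (w * chi (w * x - b - IZR z))) by ring.
    apply is_derive_scal.
    apply (is_derive_comp P (fun t => w * t - b - IZR z)); [apply HP|].
    auto_derive; [easy|ring].
Qed.

Lemma increment_bound (F F' : R -> R) kappa L s t :
  s <= t -> (forall x, is_derive F x (F' x)) ->
  (forall x, s <= x <= t -> Rabs (F' x - kappa) <= L) ->
  Rabs (F t - F s - kappa * (t - s)) <= L * (t - s).
Proof.
  intros Hst HF HL.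
  destruct (MVT_gen F s t F') as [x [Hx HE]].
  - intros; apply HF.
  - intros x _; apply continuity_pt_filterlim, (ex_derive_continuous (V := R_NormedModule)).
    eexists; apply HF.
  - rewrite HE, <- Rmult_minus_distr_r, Rabs_mult, (Rabs_pos_eq (t - s)) by lra.
    apply Rmult_le_compat_r; [lra|]; apply HL.
    rewrite Rmin_left, Rmax_right in Hx; lra.
Qed.

(** The mean value theorem is applied to the partial sums and the resulting bound passes to the
    limit, so the series itself is never differentiated. *)
Lemma Sbar_slope chi P Q M f B m w kappa L s t :
  continuity chi -> primitives chi P Q M -> (1 <= m)%nat -> (forall x, Rabs (f x) <= B) ->
  s <= t ->
  (exists N : nat, forall z n x,
     (z <= - Z.of_nat N)%Z -> (Z.of_nat N < z + Z.of_nat n)%Z -> s <= x <= t ->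
     Rabs (zsum (fun k => w * dcoef f m w k * chi (w * x - INR m / 2 - IZR k)) z n - kappa) <= L) ->
  Rabs (Sbar chi m w f t - Sbar chi m w f s - kappa * (t - s)) <= L * (t - s).
Proof.
  intros Hc Hpr Hm HB Hst [N HN].
  assert (HS := Sbar_increment chi P Q M f B m w s t Hc Hpr Hm HB).
  apply Rnot_lt_le; intros h.
  set (D := Sbar chi m w f t - Sbar chi m w f s) in *.
  destruct (HS (Rabs (D - kappa * (t - s)) - L * (t - s))) as [N' HN']; [lra|].
  set (p := max N N').
  specialize (HN' (- Z.of_nat p)%Z (S (p + p)) ltac:(lia) ltac:(lia)).
  assert (HI := increment_bound
    (fun t => zsum (fun k => dcoef f m w k * P (w * t - INR m / 2 - IZR k)) (- Z.of_nat p) (S (p + p)))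
    _ kappa L s t Hst
    (fun x => zsum_derive (dcoef f m w) chi P w (INR m / 2) _ _ x (proj1 Hpr))
    (fun x => HN (- Z.of_nat p)%Z (S (p + p)) x ltac:(lia) ltac:(lia))).
  cbv beta in HI; rewrite <- zsum_minus in HI.
  rewrite (zsum_ext _ (fun k => dcoef f m w k *
    (P (w * t - INR m / 2 - IZR k) - P (w * s - INR m / 2 - IZR k)))) in HI by (intros; ring).
  match type of HI with Rabs (?X - _) <= _ => set (S0 := X) in * end.
  rewrite Rabs_minus_sym in HN'.
  generalize (Rabs_triang (D - S0) (S0 - kappa * (t - s))).
  replace (D - S0 + (S0 - kappa * (t - s))) with (D - kappa * (t - s)) by ring; lra.
Qed.

(** The case [kappa = 0] of [Sbar_slope]: the coefficients are at most [2B / m] and the sums of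
    [|chi|] are bounded. *)
Lemma Sbar_lipschitz chi f B m w :
  chi1 chi -> chi2 chi -> (1 <= m)%nat -> 0 < w -> (forall x, Rabs (f x) <= B) ->
  exists L, 0 <= L /\ forall s t, s <= t ->
    Rabs (Sbar chi m w f t - Sbar chi m w f s) <= L * (t - s).
Proof.
  intros [Hc [HL1 _]] H2 Hm Hw HB.
  destruct (kernel_primitives chi Hc HL1) as [P [Q [M Hpr]]].
  destruct (kernel_sum_bound chi H2) as [M2 [HM0 HM2]].
  assert (Hm0 : 0 < INR m) by (apply lt_0_INR; lia).
  assert (HB0 : 0 <= B) by (eapply Rle_trans; [apply Rabs_pos|apply (HB 0)]).
  assert (HD : forall k, Rabs (dcoef f m w k) <= 2 * B / INR m).
  { intros k; unfold dcoef, Rdiv; rewrite Rabs_mult, (Rabs_pos_eq (/ INR m))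
      by (apply Rlt_le, Rinv_0_lt_compat; easy).
    apply Rmult_le_compat_r; [apply Rlt_le, Rinv_0_lt_compat; easy|].
    eapply Rle_trans; [apply Rabs_triang|]; rewrite Rabs_Ropp.
    generalize (HB (IZR (k + Z.of_nat m) * / w)) (HB (IZR k * / w)); lra. }
  set (L := w * (2 * B / INR m) * M2).
  assert (Hk : 0 <= w * (2 * B / INR m))
    by (apply Rmult_le_pos; [lra|apply Rdiv_le_0_compat; lra]).
  exists L; split; [now apply Rmult_le_pos|]; intros s t Hst.
  replace (Sbar chi m w f t - Sbar chi m w f s)
    with (Sbar chi m w f t - Sbar chi m w f s - 0 * (t - s)) by ring.
  apply (Sbar_slope chi P Q M f B); auto.
  exists 0%nat; intros z n x _ _ _; rewrite Rminus_0_r.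
  eapply Rle_trans; [apply zsum_abs|].
  apply Rle_trans with (zsum (fun k => w * (2 * B / INR m) *
      Rabs (chi (w * x - INR m / 2 - IZR k))) z n).
  - apply zsum_le; intros k _; rewrite !Rabs_mult, (Rabs_pos_eq w) by lra.
    apply Rmult_le_compat_r; [apply Rabs_pos|]; apply Rmult_le_compat_l; [lra|apply HD].
  - rewrite zsum_scal; now apply Rmult_le_compat_l.
Qed.

(** * Truncations and gluing of variation bounds *)

Lemma clamp_lipschitz a b u v : u <= v -> 0 <= clamp a b v - clamp a b u <= v - u.
Proof.
  intros H; unfold clamp, Rmax, Rmin.
  repeat destruct Rle_dec; lra.
Qed.

Lemma var_le_clamp a b : a <= b -> var_le (clamp a b) (b - a).
Proof.
  intros Hab x l Hl; apply incr_wincr in Hl.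
  assert (H : var_sum (clamp a b) x l = clamp a b (endpt x l) - clamp a b x).
  { revert x Hl; induction l as [|y l IH]; intros x; simpl; [intros; ring|].
    intros [H1 H2]; rewrite IH, Rabs_pos_eq by (auto; apply clamp_lipschitz; auto); ring. }
  rewrite H.
  generalize (clamp_bounds a b (endpt x l) Hab) (clamp_bounds a b x Hab); lra.
Qed.

Lemma var_le_lipschitz_clamp h a b L :
  a <= b -> 0 <= L ->
  (forall s t, a <= s -> s <= t -> t <= b -> Rabs (h t - h s) <= L * (t - s)) ->
  var_le (fun t => h (clamp a b t)) (L * (b - a)).
Proof.
  intros Hab HL Hh x l Hl.
  apply Rle_trans with (L * var_sum (clamp a b) x l).
  - apply incr_wincr in Hl; revert x Hl; induction l as [|y l IH]; intros x; simpl; [lra|].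
    intros [H1 H2]; specialize (IH y H2).
    assert (H3 := clamp_lipschitz a b x y H1).
    rewrite (Rabs_pos_eq (clamp a b y - _)) by easy.
    assert (Rabs (h (clamp a b y) - h (clamp a b x)) <= L * (clamp a b y - clamp a b x)).
    { apply Hh; [apply clamp_bounds; auto|lra|apply clamp_bounds; auto]. }
    lra.
  - apply Rmult_le_compat_l; [easy|now apply var_le_clamp].
Qed.

Lemma var_le_ext f g M :
  (forall u v, f v - f u = g v - g u) -> var_le g M -> var_le f M.
Proof.
  intros H Hg; rewrite <- (Rmult_1_l M), <- Rabs_R1.
  apply var_le_scal with g; [intros; rewrite H; ring|easy].
Qed.

Lemma var_le_minus f g M N :
  var_le f M -> var_le g N -> var_le (fun t => f t - g t) (M + N).
Proof.
  intros Hf Hg; apply var_le_sum with f (fun t => (-1) * g t); [intros; ring|easy|].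
  rewrite <- (Rmult_1_l N), <- Rabs_R1, <- (Rabs_Ropp 1).
  apply var_le_scal with g; [intros; ring|easy].
Qed.

Lemma var_le_split_min_max f c M N :
  var_le (fun t => f (Rmin t c)) M -> var_le (fun t => f (Rmax t c)) N -> var_le f (M + N).
Proof.
  apply var_le_sum; intros u v.
  rewrite (split_min_max f c u), (split_min_max f c v); ring.
Qed.

Lemma var_le_split_max f a b M N :
  a <= b -> var_le (fun t => f (clamp a b t)) M -> var_le (fun t => f (Rmax t b)) N ->
  var_le (fun t => f (Rmax t a)) (M + N).
Proof.
  intros H; apply var_le_sum; intros u v.
  rewrite (split_max f a b u), (split_max f a b v) by easy; ring.
Qed.

Lemma clamp_low a b t : t <= a -> clamp a b t = a.
Proof. intros H; unfold clamp; apply Rmax_left; generalize (Rmin_l t b); lra. Qed.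

Lemma clamp_high a b t : a <= b -> b <= t -> clamp a b t = b.
Proof. intros H1 H2; unfold clamp; rewrite Rmin_right, Rmax_right; lra. Qed.

Lemma clamp_id a b t : a <= t -> t <= b -> clamp a b t = t.
Proof. intros H1 H2; unfold clamp; rewrite Rmin_left, Rmax_right; lra. Qed.

(** * Convergence in variation *)

Definition Sbar_converges chi m f : Prop :=
  var_tends_to_0 (fun w t => Sbar chi m w f t - f t).

Lemma Sbar_converges_zero_var chi m f :
  chi1 chi -> (1 <= m)%nat -> var_le f 0 -> Sbar_converges chi m f.
Proof.
  intros [Hc [HL1 _]] Hm Hf eps Heps; exists 0; intros w Hw.
  destruct (kernel_primitives chi Hc HL1) as [P [Q [M Hpr]]].
  apply var_le_weaken with (M * 0 + 0); [lra|].
  apply var_le_minus; [now apply (Sbar_var chi P Q)|easy].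
Qed.

Lemma dcoef_clamp_slope a b m w k :
  0 < w -> (1 <= m)%nat -> 0 <= w * dcoef (clamp a b) m w k <= 1.
Proof.
  intros Hw Hm; assert (Hm0 : 0 < INR m) by (apply lt_0_INR; lia).
  unfold dcoef; rewrite plus_IZR, <- INR_IZR_INZ.
  assert (Hd : IZR k / w <= (IZR k + INR m) / w).
  { apply Rmult_le_compat_r; [apply Rlt_le, Rinv_0_lt_compat; easy|lra]. }
  assert (H := clamp_lipschitz a b _ _ Hd).
  replace ((IZR k + INR m) / w - IZR k / w) with (INR m / w) in H by (field; lra).
  set (D := clamp a b _ - clamp a b _) in *.
  assert (Hr : 0 < w / INR m) by (apply Rdiv_lt_0_compat; lra).
  replace (w * (D / INR m)) with (w / INR m * D) by (field; lra).
  split; [apply Rmult_le_pos; lra|].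
  replace 1 with (w / INR m * (INR m / w)) by (field; lra).
  apply Rmult_le_compat_l; lra.
Qed.

Lemma dcoef_clamp_nonzero a b m w k :
  a <= b -> 0 < w -> dcoef (clamp a b) m w k <> 0 ->
  w * a < IZR k + INR m /\ IZR k < w * b.
Proof.
  intros Hab Hw; unfold dcoef; rewrite plus_IZR, <- INR_IZR_INZ; intros H.
  assert (Hm0 := pos_INR m).
  assert (Hd : IZR k / w <= (IZR k + INR m) / w).
  { apply Rmult_le_compat_r; [apply Rlt_le, Rinv_0_lt_compat; easy|lra]. }
  assert (E1 : w * (IZR k / w) = IZR k) by (field; lra).
  assert (E2 : w * ((IZR k + INR m) / w) = IZR k + INR m) by (field; lra).
  split; apply Rnot_le_lt; intros h; apply H.
  - assert ((IZR k + INR m) / w <= a) by (apply Rmult_le_reg_l with w; lra).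
    rewrite !clamp_low by lra; unfold Rdiv; ring.
  - assert (b <= IZR k / w) by (apply Rmult_le_reg_l with w; lra).
    rewrite !clamp_high by lra; unfold Rdiv; ring.
Qed.

Lemma dcoef_clamp_inside a b m w k :
  0 < w -> (1 <= m)%nat -> w * a <= IZR k -> IZR k + INR m <= w * b ->
  w * dcoef (clamp a b) m w k = 1.
Proof.
  intros Hw Hm H1 H2; assert (Hm0 : 0 < INR m) by (apply lt_0_INR; lia).
  unfold dcoef; rewrite plus_IZR, <- INR_IZR_INZ.
  assert (E1 : w * (IZR k / w) = IZR k) by (field; lra).
  assert (E2 : w * ((IZR k + INR m) / w) = IZR k + INR m) by (field; lra).
  rewrite !clamp_id; [field; lra|..]; apply Rmult_le_reg_l with w; lra.
Qed.

(** Left of [c] the truncation is constant, and nonzero coefficients have [k > w * a - m]. The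
    argument [w * t - m/2 - k] thus stays below [-r], where [|chi|] has little mass. *)
Lemma Sbar_clamp_left chi P Q M m w a b c r delta :
  continuity chi -> primitives chi P Q M -> (1 <= m)%nat -> 0 < w -> a <= b -> 0 <= delta ->
  (forall x y, x <= y -> y <= - r \/ r <= x -> Q y - Q x <= delta) ->
  c <= a -> r + INR m / 2 <= w * (a - c) ->
  var_le (fun t => Sbar chi m w (clamp a b) (Rmin t c) - clamp a b (Rmin t c)) (delta * (b - a)).
Proof.
  intros Hc Hpr Hm Hw Hab Hd HQ Hca Hr.
  apply var_le_ext with (fun t => Sbar chi m w (clamp a b) (Rmin t c)).
  { intros u v; rewrite !(clamp_low a b); [ring|..].
    - generalize (Rmin_r u c); lra.
    - generalize (Rmin_r v c); lra. }
  apply (Sbar_var_comp chi P Q M); auto.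
  - now apply var_le_clamp.
  - intros u v; apply Rle_min_compat_r.
  - intros k u v Hk Huv.
    destruct (dcoef_clamp_nonzero a b m w k Hab Hw Hk) as [H1 H2].
    apply HQ.
    + assert (w * Rmin u c <= w * Rmin v c)
        by (apply Rmult_le_compat_l; [lra|now apply Rle_min_compat_r]); lra.
    + left; assert (w * Rmin v c <= w * c)
        by (apply Rmult_le_compat_l; [lra|apply Rmin_r]); lra.
Qed.

Lemma Sbar_clamp_right chi P Q M m w a b c r delta :
  continuity chi -> primitives chi P Q M -> (1 <= m)%nat -> 0 < w -> a <= b -> 0 <= delta ->
  (forall x y, x <= y -> y <= - r \/ r <= x -> Q y - Q x <= delta) ->
  b <= c -> r + INR m / 2 <= w * (c - b) ->
  var_le (fun t => Sbar chi m w (clamp a b) (Rmax t c) - clamp a b (Rmax t c)) (delta * (b - a)).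
Proof.
  intros Hc Hpr Hm Hw Hab Hd HQ Hca Hr.
  apply var_le_ext with (fun t => Sbar chi m w (clamp a b) (Rmax t c)).
  { intros u v; rewrite !(clamp_high a b); [ring|auto| |auto|].
    - generalize (Rmax_r u c); lra.
    - generalize (Rmax_r v c); lra. }
  apply (Sbar_var_comp chi P Q M); auto.
  - now apply var_le_clamp.
  - intros u v; apply Rle_max_compat_r.
  - intros k u v Hk Huv.
    destruct (dcoef_clamp_nonzero a b m w k Hab Hw Hk) as [H1 H2].
    apply HQ.
    + assert (w * Rmax u c <= w * Rmax v c)
        by (apply Rmult_le_compat_l; [lra|now apply Rle_max_compat_r]); lra.
    + right; assert (w * c <= w * Rmax u c)
        by (apply Rmult_le_compat_l; [lra|apply Rmax_r]); lra.
Qed.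

(** The difference quotients lie in [[0,1]], so the series has Lipschitz constant [M2] whatever [w]
    is; the truncation itself adds 1. *)
Lemma Sbar_clamp_lipschitz chi P Q M M2 m w a b s t :
  continuity chi -> primitives chi P Q M -> (1 <= m)%nat -> 0 < w -> a <= b ->
  (forall u z n, zsum (fun k => Rabs (chi (u - IZR k))) z n <= M2) -> s <= t ->
  Rabs ((Sbar chi m w (clamp a b) t - clamp a b t) - (Sbar chi m w (clamp a b) s - clamp a b s))
    <= (M2 + 1) * (t - s).
Proof.
  intros Hc Hpr Hm Hw Hab HM2 Hst.
  destruct (BV_bounded (clamp a b) (ex_intro _ _ (var_le_clamp a b Hab))) as [B HB].
  assert (H : Rabs (Sbar chi m w (clamp a b) t - Sbar chi m w (clamp a b) s - 0 * (t - s))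
     <= M2 * (t - s)).
  { apply (Sbar_slope chi P Q M (clamp a b) B); auto.
    exists 0%nat; intros z n x _ _ _; rewrite Rminus_0_r.
    eapply Rle_trans; [apply zsum_abs|].
    eapply Rle_trans; [|apply (HM2 (w * x - INR m / 2) z n)].
    apply zsum_le; intros k _; rewrite Rabs_mult.
    apply Rle_trans with (1 * Rabs (chi (w * x - INR m / 2 - IZR k))); [|lra].
    apply Rmult_le_compat_r; [apply Rabs_pos|].
    generalize (dcoef_clamp_slope a b m w k Hw Hm); intros; apply Rabs_le; lra. }
  rewrite Rmult_0_l, Rminus_0_r in H.
  assert (H1 := clamp_lipschitz a b s t Hst).
  apply Rabs_le_between in H; apply Rabs_le; lra.
Qed.

(** At distance [eta] from [a] and [b], every [k] within [r] of [w * x - m/2] has [[k, k + m]]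
    inside [[w * a, w * b]], hence weight 1, and the slope of the series is close to 1. *)
Lemma Sbar_clamp_inside chi P Q M m w a b eta r eps s t :
  continuity chi -> primitives chi P Q M -> (1 <= m)%nat -> 0 < w -> a <= b -> 0 <= eta ->
  (forall u (q : Z -> R) z n,
    (forall k, 0 <= q k <= 1) -> (forall k, Rabs (u - IZR k) <= r -> q k = 1) ->
    (forall k, Rabs (u - IZR k) <= r -> (z <= k < z + Z.of_nat n)%Z) ->
    Rabs (zsum (fun k => q k * chi (u - IZR k)) z n - 1) <= eps) ->
  r + INR m / 2 <= w * eta -> a + eta <= s -> s <= t -> t <= b - eta ->
  Rabs ((Sbar chi m w (clamp a b) t - clamp a b t) - (Sbar chi m w (clamp a b) s - clamp a b s))
    <= eps * (t - s).
Proof.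
  intros Hc Hpr Hm Hw Hab Heta Hone Hr Has Hst Htb.
  destruct (BV_bounded (clamp a b) (ex_intro _ _ (var_le_clamp a b Hab))) as [B HB].
  rewrite !clamp_id by lra.
  replace (Sbar chi m w (clamp a b) t - t - (Sbar chi m w (clamp a b) s - s))
    with (Sbar chi m w (clamp a b) t - Sbar chi m w (clamp a b) s - 1 * (t - s)) by ring.
  apply (Sbar_slope chi P Q M (clamp a b) B); auto.
  set (p := w * Rabs a + w * Rabs b).
  assert (Hp : - p <= w * a /\ w * b <= p).
  { unfold p; generalize (Rabs_pos a) (Rabs_pos b) (Rle_abs b) (Rle_abs (- a)).
    rewrite Rabs_Ropp; intros; split; nra. }
  exists (Z.to_nat (up p)); intros z n x Hz Hn Hx.
  assert (Hwx : w * (a + eta) <= w * x <= w * (b - eta))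
    by (split; apply Rmult_le_compat_l; lra).
  assert (Hin : forall k, Rabs (w * x - INR m / 2 - IZR k) <= r ->
     w * a <= IZR k /\ IZR k + INR m <= w * b).
  { intros k Hk; apply Rabs_le_between in Hk; lra. }
  apply (Hone (w * x - INR m / 2) (fun k => w * dcoef (clamp a b) m w k)).
  - intros k; now apply dcoef_clamp_slope.
  - intros k Hk; apply dcoef_clamp_inside; auto; now apply Hin.
  - intros k Hk; apply Hin in Hk; assert (Hm0 := pos_INR m).
    destruct (archimed p) as [Ha _].
    assert (k < up p)%Z by (apply lt_IZR; lra).
    assert (- up p < k)%Z by (apply lt_IZR; rewrite opp_IZR; lra).
    lia.
Qed.

Lemma Sbar_converges_clamp chi m a b :
  chi1 chi -> chi2 chi -> (1 <= m)%nat -> a <= b -> Sbar_converges chi m (clamp a b).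
Proof.
  intros H1 H2 Hm [Hab|Hab].
  2: { subst; apply Sbar_converges_zero_var; auto.
       rewrite <- (Rminus_diag b); apply var_le_clamp; lra. }
  intros eps Heps.
  destruct (kernel_primitives chi (proj1 H1) (proj1 (proj2 H1))) as [P [Q [M Hpr]]].
  destruct (kernel_sum_bound chi H2) as [M2 [HM0 HM2]].
  set (delta := eps / (8 * (b - a))).
  assert (Hd : 0 < delta) by (apply Rdiv_lt_0_compat; lra).
  destruct (primitive_tail Q M delta (proj2 (proj2 Hpr)) Hd) as [r1 [Hr1 HQ]].
  destruct (kernel_sum_near_one chi delta H1 H2 Hd) as [r2 [Hr2 Hone]].
  (* The first bound keeps [a + eta <= b - eta]; the second makes the variation on each interval of
     length [2 * eta] around [a] and [b] at most [eps / 8]. *)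
  set (eta := Rmin ((b - a) / 2) (eps / (16 * (M2 + 1)))).
  assert (Heta : 0 < eta) by (apply Rmin_glb_lt; apply Rdiv_lt_0_compat; lra).
  assert (Heta1 : eta <= (b - a) / 2) by apply Rmin_l.
  assert (Heta2 : (M2 + 1) * (2 * eta) <= eps / 8).
  { replace (eps / 8) with ((M2 + 1) * (2 * (eps / (16 * (M2 + 1))))) by (field; lra).
    apply Rmult_le_compat_l; [lra|]; apply Rmult_le_compat_l; [lra|apply Rmin_r]. }
  assert (Hm0 := pos_INR m).
  exists ((r1 + r2 + INR m) / eta); intros w Hw.
  assert (Hweta : r1 + r2 + INR m < w * eta).
  { replace (r1 + r2 + INR m) with ((r1 + r2 + INR m) / eta * eta) by (field; lra).
    now apply Rmult_lt_compat_r. }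
  assert (Hw0 : 0 < w).
  { apply Rle_lt_trans with (2 := Hw); apply Rdiv_le_0_compat; lra. }
  set (h := fun t => Sbar chi m w (clamp a b) t - clamp a b t).
  assert (Hc := proj1 H1).
  assert (Hdab : delta * (b - a) = eps / 8) by (unfold delta; field; lra).
  assert (Lip : forall c d, c <= d -> d - c = 2 * eta ->
     var_le (fun t => h (clamp c d t)) (eps / 8)).
  { intros c d Hcd Hcd2; apply var_le_weaken with ((M2 + 1) * (d - c)); [rewrite Hcd2; easy|].
    apply var_le_lipschitz_clamp; [easy|lra|]; intros s t _ Hst _.
    apply (Sbar_clamp_lipschitz chi P Q M); auto; lra. }
  set (c1 := a - eta); set (c2 := a + eta); set (c3 := b - eta); set (c4 := b + eta).
  assert (V1 : var_le (fun t => h (Rmin t c1)) (eps / 8)).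
  { rewrite <- Hdab; apply (Sbar_clamp_left chi P Q M m w a b c1 r1); auto; unfold c1; lra. }
  assert (V2 := Lip c1 c2 ltac:(unfold c1, c2; lra) ltac:(unfold c1, c2; ring)).
  assert (V3 : var_le (fun t => h (clamp c2 c3 t)) (eps / 8)).
  { apply var_le_weaken with (delta * (c3 - c2)).
    - rewrite <- Hdab; apply Rmult_le_compat_l; unfold c2, c3; lra.
    - apply var_le_lipschitz_clamp; [unfold c2, c3; lra|lra|]; intros s t Hs Hst Ht.
      apply (Sbar_clamp_inside chi P Q M m w a b eta r2); auto; lra. }
  assert (V4 := Lip c3 c4 ltac:(unfold c3, c4; lra) ltac:(unfold c3, c4; ring)).
  assert (V5 : var_le (fun t => h (Rmax t c4)) (eps / 8)).
  { rewrite <- Hdab; apply (Sbar_clamp_right chi P Q M m w a b c4 r1); auto; unfold c4; lra. }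
  apply var_le_weaken with (eps / 8 + (eps / 8 + (eps / 8 + (eps / 8 + eps / 8)))); [lra|].
  change (var_le h (eps / 8 + (eps / 8 + (eps / 8 + (eps / 8 + eps / 8))))).
  apply var_le_split_min_max with c1; [exact V1|].
  apply var_le_split_max with c2; [unfold c1, c2; lra|exact V2|].
  apply var_le_split_max with c3; [unfold c2, c3; lra|exact V3|].
  apply var_le_split_max with c4; [unfold c3, c4; lra|exact V4|exact V5].
Qed.

(** Since [Sbar] is a chosen limit, linearity rests on convergence, from boundedness of the
    functions, and on uniqueness of limits. *)
Lemma Sbar_linear chi m w c f g h t :
  chi1 chi -> (1 <= m)%nat -> BV g -> BV h -> (forall x, f x = c * g x + h x) ->
  Sbar chi m w f t = c * Sbar chi m w g t + Sbar chi m w h t.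
Proof.
  intros [Hc [HL1 _]] Hm Hg Hh Hf.
  destruct (kernel_primitives chi Hc HL1) as [P [Q [M Hpr]]].
  destruct (BV_bounded g Hg) as [B HB]; destruct (BV_bounded h Hh) as [B' HB'].
  assert (HBf : forall x, Rabs (f x) <= Rabs c * B + B').
  { intros x; rewrite Hf; eapply Rle_trans; [apply Rabs_triang|]; rewrite Rabs_mult.
    apply Rplus_le_compat; [apply Rmult_le_compat_l; [apply Rabs_pos|auto]|auto]. }
  apply (zcv_unique _ _ _ (Sbar_zcv chi P Q M f _ m w t Hc Hpr Hm HBf)).
  apply zcv_ext with (2 := zcv_plus _ _ _ _
    (zcv_scal c _ _ (Sbar_zcv chi P Q M g _ m w t Hc Hpr Hm HB))
    (Sbar_zcv chi P Q M h _ m w t Hc Hpr Hm HB')).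
  intros k; cbv beta; rewrite Hf; ring.
Qed.

Lemma Sbar_converges_linear chi m c f g h :
  chi1 chi -> (1 <= m)%nat -> BV g -> BV h -> (forall x, f x = c * g x + h x) ->
  Sbar_converges chi m g -> Sbar_converges chi m h -> Sbar_converges chi m f.
Proof.
  intros H1 Hm Hg Hh Hf Cg Ch eps Heps; assert (Hc0 := Rabs_pos c).
  destruct (Cg (eps / (2 * (Rabs c + 1)))) as [W1 HW1]; [apply Rdiv_lt_0_compat; lra|].
  destruct (Ch (eps / 2)) as [W2 HW2]; [lra|].
  exists (Rmax W1 W2); intros w Hw.
  assert (HwW1 : W1 < w) by (apply Rle_lt_trans with (2 := Hw), Rmax_l).
  assert (HwW2 : W2 < w) by (apply Rle_lt_trans with (2 := Hw), Rmax_r).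
  apply var_le_weaken with (Rabs c * (eps / (2 * (Rabs c + 1))) + eps / 2).
  { assert (Rabs c * (eps / (2 * (Rabs c + 1))) <= (Rabs c + 1) * (eps / (2 * (Rabs c + 1)))).
    { apply Rmult_le_compat_r; [apply Rlt_le, Rdiv_lt_0_compat|]; lra. }
    replace ((Rabs c + 1) * (eps / (2 * (Rabs c + 1)))) with (eps / 2) in H by (field; lra); lra. }
  apply var_le_sum with (fun t => c * (Sbar chi m w g t - g t)) (fun t => Sbar chi m w h t - h t); auto.
  - intros u v; rewrite !(Sbar_linear chi m w c f g h), !Hf by auto; ring.
  - apply var_le_scal with (2 := HW1 w HwW1); intros; ring.
Qed.

Lemma polygon_BV f x l : wincr x l -> BV (polygon f x l).
Proof.
  revert x; induction l as [|y l IH]; intros x.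
  - intros _; exists (Rabs 0 * (x - x)).
    apply var_le_scal with (clamp x x); [intros; simpl; ring|apply var_le_clamp; lra].
  - intros [Hx Hl]; destruct (IH y Hl) as [V HV].
    exists (Rabs (slope f x y) * (y - x) + V).
    apply var_le_sum with (fun t => slope f x y * clamp x y t) (polygon f y l); auto.
    + intros u v; cbn [polygon]; ring.
    + apply var_le_scal with (clamp x y); [intros; ring|now apply var_le_clamp].
Qed.

Lemma Sbar_converges_polygon chi m f x l :
  chi1 chi -> chi2 chi -> (1 <= m)%nat -> wincr x l -> Sbar_converges chi m (polygon f x l).
Proof.
  intros H1 H2 Hm; revert x; induction l as [|y l IH]; intros x.
  - intros _; apply Sbar_converges_zero_var; auto.
    rewrite <- (Rmult_0_r (Rabs 0)), <- (Rminus_diag x).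
    apply var_le_scal with (clamp x x); [intros; simpl; ring|apply var_le_clamp; lra].
  - intros [Hx Hl].
    apply Sbar_converges_linear with (slope f x y) (clamp x y) (polygon f y l); auto.
    + exists (y - x); now apply var_le_clamp.
    + now apply polygon_BV.
    + now apply Sbar_converges_clamp.
Qed.

Lemma Sbar_converges_AC chi m f :
  chi1 chi -> chi2 chi -> (1 <= m)%nat -> AC f -> Sbar_converges chi m f.
Proof.
  intros H1 H2 Hm Hf eps Heps.
  destruct (kernel_primitives chi (proj1 H1) (proj1 (proj2 H1))) as [P [Q [M Hpr]]].
  assert (HM : 0 <= M) by (generalize (proj2 (proj2 Hpr) 0 0 (Rle_refl 0)); lra).
  (* With [V[f - g] <= d], the remainder [h = f - g] contributes at most [M * d + d = eps / 2],
     uniformly in [w > 0]. *)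
  set (d := eps / (2 * (M + 1))); assert (Hd : 0 < d) by (apply Rdiv_lt_0_compat; lra).
  destruct (AC_polygon_approx f d Hf Hd) as [x [l [Hl Hg]]].
  set (g := polygon f x l) in *; set (h := fun t => f t - g t) in *.
  destruct (Sbar_converges_polygon chi m f x l H1 H2 Hm Hl (eps / 2)) as [W HW]; [lra|].
  fold g in HW; exists (Rmax 0 W); intros w Hw.
  assert (HwW : W < w) by (apply Rle_lt_trans with (2 := Hw), Rmax_r).
  assert (Hw0 : 0 < w) by (apply Rle_lt_trans with (2 := Hw), Rmax_l).
  assert (Hh : var_le (fun t => Sbar chi m w h t - h t) (M * d + d)).
  { apply var_le_minus; [|easy]; apply (Sbar_var chi P Q); auto; apply H1. }
  apply var_le_weaken with (M * d + d + eps / 2); [apply Req_le; unfold d; field; lra|].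
  apply var_le_sum with (2 := Hh) (3 := HW w HwW); intros u v.
  assert (HS : forall t, Sbar chi m w f t = 1 * Sbar chi m w h t + Sbar chi m w g t).
  { intros t; apply Sbar_linear; auto.
    - now exists d.
    - now apply polygon_BV.
    - intros y; unfold h; ring. }
  rewrite !HS; unfold h; ring.
Qed.

(** * Necessity of absolute continuity *)

(** The end points of nonoverlapping intervals form a partition; the gaps only add nonnegative terms
    to the variation of [f - g]. *)
Lemma osc_sum_split f g L M a l :
  (forall s t, s <= t -> Rabs (f t - f s) <= L * (t - s)) ->
  var_le (fun t => f t - g t) M -> nonoverlap a l ->
  osc_sum g l <= L * len_sum l + M.
Proof.
  intros HL HM Hl.
  assert (H : exists l', wincr a l' /\
     osc_sum g l <= L * len_sum l + var_sum (fun t => f t - g t) a l').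
  { revert a Hl; induction l as [|[x y] l IH]; intros a.
    - intros _; exists nil; simpl; split; [easy|lra].
    - intros [H1 [H2 H3]]; destruct (IH y H3) as [l' [H4 H5]].
      exists (x :: y :: l'); split; [simpl; repeat split; auto; lra|].
      cbn [osc_sum len_sum var_sum].
      assert (H6 := HL x y ltac:(lra)).
      generalize (Rabs_pos (f x - g x - (f a - g a))).
      assert (H7 : Rabs (g y - g x) <= Rabs (f y - f x) + Rabs (f y - g y - (f x - g x))).
      { rewrite <- (Rabs_Ropp (f y - g y - _)).
        eapply Rle_trans; [|apply Rabs_triang]; apply Req_le; f_equal; ring. }
      lra. }
  destruct H as [l' [H1 H2]].
  generalize (var_le_wincr _ M a l' HM H1); lra.
Qed.

Theorem theorem3p3 (chi : R -> R) (m : nat) (f : R -> R) :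
  chi1 chi -> chi2 chi -> (1 <= m)%nat -> BV f ->
  (var_tends_to_0 (fun w t => Sbar chi m w f t - f t) <-> AC f).
Proof.
  intros H1 H2 Hm Hf; split; [|now apply Sbar_converges_AC].
  intros Hlim; split; [easy|]; intros a b _ eps Heps.
  destruct (Hlim (eps / 2)) as [W HW]; [lra|].
  (* A single large [w] suffices: [f] is then a Lipschitz function up to an error of variation at
     most [eps / 2]. *)
  set (w := Rmax 0 W + 1).
  assert (Hw0 : 0 < w) by (generalize (Rmax_l 0 W); unfold w; lra).
  assert (HwW : W < w) by (generalize (Rmax_r 0 W); unfold w; lra).
  destruct (BV_bounded f Hf) as [B HB].
  destruct (Sbar_lipschitz chi f B m w H1 H2 Hm Hw0 HB) as [L [HL0 HL]].
  exists (eps / (2 * (L + 1))); split; [apply Rdiv_lt_0_compat; lra|].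
  intros l Hl _ Hlen.
  assert (Ho := osc_sum_split _ f L (eps / 2) a l HL (HW w HwW) Hl).
  assert (Hlt : (L + 1) * len_sum l < eps / 2).
  { replace (eps / 2) with ((L + 1) * (eps / (2 * (L + 1)))) by (field; lra).
    apply Rmult_lt_compat_l; lra. }
  assert (Hpos : 0 <= len_sum l).
  { clear - Hl; revert a Hl; induction l as [|[x y] l IH]; simpl; intros a; [lra|].
    intros [H1 [H2 H3]]; specialize (IH y H3); lra. }
  lra.
Qed.
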